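(* Let $p\in[1,+\infty]$, $(z_0,z_1)\in\mathsf X_p$, and let $$\Sigma=\left((-\infty,0]\times\{-\sqrt2\}\right)\cup\left(\{0\}\times[-\sqrt2,\sqrt2]\right)\cup\left([0,+\infty)\times\{\sqrt2\}\right).$$ Let $z$ be the solution in $\mathsf X_p$ of the wave equation associated with $\Sigma$ with initial condition $(z_0,z_1)$. Let $g_0=\mathfrak I(z_0,z_1)\in\mathsf Y_p$, let $K(s)=\left\lfloor\frac{|g_0(s)|+1}2\right\rfloor$ and $$g_\infty(s)=(-1)^{K(s)}\frac{g_0(s)}{|g_0(s)|}\left(|g_0(s)|-2K(s)\right),\qquad s\in[-1,1]$$ (read as $g_\infty(s)=0$ when $g_0(s)=0$), and let $z_\infty$ be the solution of the wave equation associated with $\Sigma$ starting at $\mathfrak I^{-1}(g_\infty)$. Then $z_\infty$ is $2$-periodic (in time) and $z(t)-z_\infty(t)$ converges to $0$ in $\mathsf X_p$ as $t\to+\infty$. Moreover, if $p=+\infty$, the convergence takes place in finite time less than or equal to $T=2\left\lfloor\frac{\|(z_0,z_1)\|_{\mathsf X_\infty}+1}2\right\rfloor$, i.e., $z(t)=z_\infty(t)$ for $t\ge T$.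
   Context: Notation: $\mathbb R_+=[0,+\infty)$, $R=\begin{pmatrix}\frac1{\sqrt2}&\frac1{\sqrt2}\\-\frac1{\sqrt2}&\frac1{\sqrt2}\end{pmatrix}$. $L^p_{\mathrm{loc}}(a,+\infty)$ is the set of measurable functions whose restriction to $(a,T)$ is in $L^p$ for every $T>a$. $W^{1,p}_*(0,1)=\{u\in L^p(0,1): u'\in L^p(0,1),\ u(0)=0\}$ and $\mathsf X_p=W^{1,p}_*(0,1)\times L^p(0,1)$, with norm $\|(u,v)\|_{\mathsf X_p}^p=2^{-p/2}\int_0^1(|u'+v|^p+|u'-v|^p)\,dx$ if $p<+\infty$ and $\|(u,v)\|_{\mathsf X_\infty}=\frac1{\sqrt2}\max(\|u'+v\|_{L^\infty(0,1)},\|u'-v\|_{L^\infty(0,1)})$. $\mathsf Y_p=L^p(-1,1)$. $\mathfrak I:\mathsf X_p\to\mathsf Y_p$ is the isometry mapping $(z_0,z_1)$ to the function $g_0$ defined by $\begin{pmatrix} g_0(-s) \\ g_0(s) \end{pmatrix}=R\begin{pmatrix} z_1(s) \\ -z_0'(s) \end{pmatrix}$ for a.e. $s\in[0,1]$. The wave equation associated with $\Sigma$ is: $z_{tt}=z_{xx}$ on $\mathbb R_+\times[0,1]$; $z(t,0)=0$ and $(z_t(t,1),-z_x(t,1))\in\Sigma$ for $t\in\mathbb R_+$; $z(0,x)=z_0(x)$, $z_t(0,x)=z_1(x)$ for $x\in[0,1]$. A (weak, global in time) solution in $\mathsf X_p$ with initial condition (or starting at) $(z_0,z_1)\in\mathsf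 X_p$ is a function $z:\mathbb R_+\times[0,1]\to\mathbb R$ for which there exist $f\in L^p_{\mathrm{loc}}(0,+\infty)$ and $g\in L^p_{\mathrm{loc}}(-1,+\infty)$ such that $z(t,x)=\frac1{\sqrt2}\int_0^{t+x}f+\frac1{\sqrt2}\int_0^{t-x}g$ for all $(t,x)\in\mathbb R_+\times[0,1]$, $z(t,0)=0$ and $(z_t(t,1),-z_x(t,1))\in\Sigma$ for a.e. $t\in\mathbb R_+$, and $z(0,x)=z_0(x)$, $z_t(0,x)=z_1(x)$ for a.e. $x\in[0,1]$; here $z_t(t,x)=\frac{f(t+x)+g(t-x)}{\sqrt2}$ and $z_x(t,x)=\frac{f(t+x)-g(t-x)}{\sqrt2}$. For this $\Sigma$ the solution exists and is unique for every initial condition in $\mathsf X_p$. In statements about $\mathsf X_p$, $z(t)$ stands for the pair $(z(t,\cdot),z_t(t,\cdot))\in\mathsf X_p$. *)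

(* Defs.v *)
From HB Require Import structures.
From mathcomp Require Export all_boot all_order all_algebra.
From mathcomp Require Export all_classical all_reals all_analysis.
Export Order.TTheory GRing.Theory Num.Theory.
Export numFieldNormedType.Exports.

Set Implicit Arguments.
Unset Strict Implicit.
Unset Printing Implicit Defensive.

Local Open Scope classical_set_scope.
Local Open Scope ring_scope.

(* Elements of function spaces on an interval are represented by total
   functions R -> R whose values outside the interval are irrelevant; equality
   in L^p is almost everywhere equality on the interval. *)

Section WaveEquation.
Context {R : realType}.
Local Notation mu := (@lebesgue_measure R).

Definition inLp (p : \bar R) (D : set R) (f : R -> R) : Prop :=
  f \_ D \in Lfun mu p.

Definition inLploc (p : \bar R) (a : R) (f : R -> R) : Prop :=
  measurable_fun `]a, +oo[ f /\ forall T, a < T -> inLp p `]a, T[ f.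

Definition ointegral (f : R -> R) (a b : R) : R :=
  if a <= b then \int[mu]_(x in `]a, b[) f x
  else - \int[mu]_(x in `]b, a[) f x.

(* C^1_c(0, 1); testing against C^oo_c(0, 1) gives the same weak derivative, by
   mollification. *)
Definition test_function (phi : R -> R) : Prop :=
  [/\ forall x, derivable phi x 1,
      continuous (derive1 phi) &
      exists a b : R, [/\ 0 < a, b < 1 &
        forall x, phi x != 0 -> a <= x <= b]].

Definition is_weak_derivative (u w : R -> R) : Prop :=
  mu.-integrable `]0, 1[ (EFin \o w) /\
  forall phi, test_function phi ->
    \int[mu]_(x in `]0, 1[) (u x * (derive1 phi) x) =
    - \int[mu]_(x in `]0, 1[) (w x * phi x).

(* A representative of the weak derivative u' (unique almost everywhere on
   (0, 1)); it is a junk function if u has no weak derivative in L^1(0, 1). *)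
Definition weak_derivative (u : R -> R) : R -> R :=
  get [set w | is_weak_derivative u w].

(* An element of W^{1,p}(0, 1) is identified with its continuous representative
   on [0, 1], so that its value at 0 makes sense. *)
Definition inW1pstar (p : \bar R) (u : R -> R) : Prop :=
  [/\ {within `[0, 1], continuous u},
      inLp p `]0, 1[ u,
      exists2 w, is_weak_derivative u w & inLp p `]0, 1[ w &
      u 0 = 0].

Definition state : Type := ((R -> R) * (R -> R))%type.

Definition inX (p : \bar R) (U : state) : Prop :=
  inW1pstar p U.1 /\ inLp p `]0, 1[ U.2.

Definition eqX (U V : state) : Prop :=
  (forall x, 0 <= x <= 1 -> U.1 x = V.1 x) /\
  {ae mu, forall x, 0 < x < 1 -> U.2 x = V.2 x}.

Definition subX (U V : state) : state :=
  (fun x => U.1 x - V.1 x, fun x => U.2 x - V.2 x).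

(* Only meaningful for 1 <= p <= +oo. *)
Definition normX (p : \bar R) (U : state) : \bar R :=
  let du := weak_derivative U.1 in
  let v := U.2 in
  match p with
  | r%:E =>
      (((2 `^ (- (r / 2)))%:E *
        \int[mu]_(x in `]0%R, 1%R[)
          (`|du x + v x| `^ r + `|du x - v x| `^ r)%:E) `^ r^-1)%E
  | +oo%E =>
      (((Num.sqrt 2)^-1)%:E *
        maxe 'N[mu]_+oo[EFin \o ((fun x => du x + v x)%R \_ `]0%R, 1%R[)]
             'N[mu]_+oo[EFin \o ((fun x => du x - v x)%R \_ `]0%R, 1%R[)])%E
  | -oo%E => 0%E
  end.

Definition inY (p : \bar R) (g : R -> R) : Prop := inLp p `]-1, 1[ g.

Definition vec2 (a b : R) : 'cV[R]_2 := \col_(i < 2) [:: a; b]`_i.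

Definition rotR : 'M[R]_2 :=
  let c := (Num.sqrt 2)^-1 in
  \matrix_(i < 2, j < 2) (nth [::] [:: [:: c; c]; [:: - c; c]] i)`_j.

(* [isI U g] means that g represents the image of U by the isometry I. *)
Definition isI (U : state) (g : R -> R) : Prop :=
  {ae mu, forall s, 0 <= s <= 1 ->
    vec2 (g (- s)) (g s) = rotR *m vec2 (U.2 s) (- weak_derivative U.1 s)}.

Definition wave_t (f g : R -> R) (t x : R) : R :=
  (f (t + x) + g (t - x)) / Num.sqrt 2.

Definition wave_x (f g : R -> R) (t x : R) : R :=
  (f (t + x) - g (t - x)) / Num.sqrt 2.

(* z is a solution in X_p starting at U, with f and g as in the d'Alembert
   decomposition of z. The functions f and g are determined by z almost
   everywhere; they are needed to express z_t and z_x. *)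
Definition wave_solution (p : \bar R) (Sigma : set (R * R)) (U : state)
    (z : R -> R -> R) (f g : R -> R) : Prop :=
  [/\ inLploc p 0 f /\ inLploc p (-1) g,
      forall t x, 0 <= t -> 0 <= x <= 1 ->
        z t x = (Num.sqrt 2)^-1 * ointegral f 0 (t + x) +
                (Num.sqrt 2)^-1 * ointegral g 0 (t - x),
      {ae mu, forall t, 0 <= t ->
        z t 0 = 0 /\ Sigma (wave_t f g t 1, - wave_x f g t 1)} &
      {ae mu, forall x, 0 <= x <= 1 ->
        z 0 x = U.1 x /\ wave_t f g 0 x = U.2 x}].

(* The pair (z(t, .), z_t(t, .)). *)
Definition traj (z : R -> R -> R) (f g : R -> R) (t : R) : state :=
  (z t, wave_t f g t).

Definition SigmaSign : set (R * R) :=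
  ([set x | x <= 0] `*` [set - Num.sqrt 2]) `|`
  ([set 0] `*` [set y | - Num.sqrt 2 <= y <= Num.sqrt 2]) `|`
  ([set x | 0 <= x] `*` [set Num.sqrt 2]).

Definition Kfun (g0 : R -> R) (s : R) : int :=
  Num.floor ((`|g0 s| + 1) / 2).

(* Since x / 0 = 0, this vanishes where g0 does. *)
Definition ginf (g0 : R -> R) (s : R) : R :=
  (-1) ^ Kfun g0 s * (g0 s / `|g0 s|) * (`|g0 s| - 2 * (Kfun g0 s)%:~R).

End WaveEquation.

(* Main.v *)
Require Import Defs.
From mathcomp Require Import ess_sup_inf measurable_realfun ring lra.

(** In the d'Alembert decomposition, the condition [z t 0 = 0] forces [f = - g] on
    the positive half-line, so a solution is encoded by the single function [g]
    on [(-1, +oo)]: the state at time [t] is the image under the inverse of the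
    isometry of the window of [g] on [(t - 1, t + 1)] ([wave_profile],
    [wave_t_profile], [isI_profile]). In particular the initial state is encoded
    by [g = g0] on [(-1, 1)] ([wave_isI]).

    The condition at [x = 1] becomes the recurrence [g (2 + s) = fold (g s)]
    ([wave_fold]), where [fold] is the identity on [[-1, 1]] and reflects larger
    values about 1 or -1. Iterating [fold] brings every real [a] into [[-1, 1]],
    where it stays: the iterates are constant as soon as [`|a| <= 2 n + 1]
    ([iter_fold_limit]), and their final value is the formula defining [ginf]
    ([fold_limit]). Hence [ginf g0] takes values fixed by [fold], its solution is
    2-periodic, and [g - ginf] on the [n]-th window of length 2 is
    [iter n fold (g s) - fold_limit (g s)] ([wave_sub_limit]). This vanishes for
    [n] large at each point and is bounded by [2 * `|g s|], so dominated
    convergence gives the limit for finite [p] ([window_energy_cvg0]). For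
    infinite [p], [g0] is bounded by the norm of the initial state
    ([normX_oo_ge]), so the difference vanishes almost everywhere from a fixed
    window on ([wave_finite_time]).

    The norm of X_p involves a weak derivative, which is identified in two steps:
    a primitive of an L^1 function has that function as a weak derivative
    ([is_weak_derivative_primitive]), and an L^1 function orthogonal to all test
    functions vanishes ([du_bois_reymond]). *)

Local Open Scope classical_set_scope.
Local Open Scope ring_scope.

Section WaveConvergence.
Set Implicit Arguments.
Unset Strict Implicit.
Unset Printing Implicit Defensive.
Context {R : realType}.
Local Notation mu := (@lebesgue_measure R).
Local Notation mR := (measurableTypeR R).

(** * Almost everywhere statements and isometries of the line *)

Lemma aeS (P Q : R -> Prop) : (forall x, P x -> Q x) ->
  {ae mu, forall x, P x} -> {ae mu, forall x, Q x}.
Proof.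
move=> PQ [N [mN N0 sN]]; exists N; split=> // x /= nQ; apply: sN => /= Px.
exact/nQ/PQ.
Qed.

Lemma aeS2 (P Q S : R -> Prop) : (forall x, P x -> Q x -> S x) ->
  {ae mu, forall x, P x} -> {ae mu, forall x, Q x} -> {ae mu, forall x, S x}.
Proof.
move=> PQS [N [mN N0 sN]] [M [mM M0 sM]]; exists (N `|` M); split.
- exact: measurableU.
- exact: null_set_setU.
- move=> x /= nS; have [Px|nP] := pselect (P x); last by left; exact: sN.
  by right; apply: sM => /= Qx; exact/nS/PQS.
Qed.

Lemma aeI (P Q : R -> Prop) : {ae mu, forall x, P x} ->
  {ae mu, forall x, Q x} -> {ae mu, forall x, P x /\ Q x}.
Proof. exact: (aeS2 (fun x => @conj _ _)). Qed.

Lemma ae_forall_nat (P : nat -> R -> Prop) :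
  (forall n, {ae mu, forall x, P n x}) -> {ae mu, forall x, forall n, P n x}.
Proof.
move=> aP; have : mu.-negligible (\bigcup_n ~` [set x | P n x]).
  by apply: negligible_bigcup => n; exact: aP.
case=> N [mN N0 sN]; exists N; split=> // x /= /existsNP[n nP].
by apply: sN; exists n.
Qed.

(** The line is only ever moved by translations and reflections; both preserve
    Lebesgue measure, so null sets, measurability and integrals are transported
    without any regularity of the integrand. *)
Definition measure_preserving (phi : mR -> mR) :=
  measurable_fun setT phi /\
  forall A : set mR, measurable A -> mu (phi @^-1` A) = mu A.

Lemma preserving_shift a : measure_preserving (fun x => a + x).
Proof.
have mphi : measurable_fun setT (fun x : mR => a + x : mR) by exact: measurable_funD.
split=> // A mA.
pose nu := pushforward mu (fun x : mR => a + x : mR).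
rewrite -[LHS]/(nu A); apply/esym/(lebesgue_measure_unique _ mA) => _ [[b c] _ <-].
transitivity (mu `]b - a, c - a]); last first.
  congr (mu _).
  by apply/seteqP; split=> x /=; rewrite !in_itv/= ltrBlDl lerBrDl.
rewrite [LHS]lebesgue_measure_itv [RHS]lebesgue_measure_itv/= !lte_fin ltrD2r.
by case: ifP => // _; rewrite -!EFinB; congr EFin; ring.
Qed.

Lemma preserving_reflect a : measure_preserving (fun x => a - x).
Proof.
have mphi : measurable_fun setT (fun x : mR => a - x : mR).
  by apply: measurable_funB.
split=> // A mA.
pose nu := pushforward mu (fun x : mR => a - x : mR).
rewrite -[LHS]/(nu A); apply/esym/(lebesgue_measure_unique _ mA) => _ [[b c] _ <-].
transitivity (mu `[a - c, a - b[); last first.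
  congr (mu _).
  apply/seteqP; split=> x /=; rewrite !in_itv/=.
    by move=> /andP[h1 h2]; apply/andP; split; lra.
  by move=> /andP[h1 h2]; apply/andP; split; lra.
rewrite [LHS]lebesgue_measure_itv [RHS]lebesgue_measure_itv/= !lte_fin.
rewrite ltrD2l ltrN2.
by case: ifP => // _; rewrite -!EFinB; congr EFin; ring.
Qed.

Lemma preserving_ae phi (hphi : measure_preserving phi) (P : R -> Prop) :
  {ae mu, forall x, P x} -> {ae mu, forall x, P (phi x)}.
Proof.
case: hphi => mphi mmu [N [mN N0 sN]]; exists (phi @^-1` N); split.
- by rewrite -[X in measurable X]setTI; exact: mphi.
- by rewrite mmu.
- by move=> x nPx; exact: sN.
Qed.

Lemma preserving_preimage phi (hphi : measure_preserving phi) D :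
  measurable D -> measurable (phi @^-1` D).
Proof. by move=> mD; rewrite -[X in measurable X]setTI; apply: hphi.1. Qed.

Lemma preserving_measurable phi (hphi : measure_preserving phi)
    d (T : sigmaRingType d) (D : set mR) (f : mR -> T) :
  measurable D -> measurable_fun D f ->
  measurable_fun (phi @^-1` D) (f \o phi).
Proof.
move=> mD mf; apply: (measurable_comp mD _ mf).
- by move=> _ [x Dx <-].
- by apply: measurable_funTS; exact: hphi.1.
Qed.

Lemma preserving_integral phi (hphi : measure_preserving phi)
    (D : set R) (f : R -> \bar R) :
  measurable D -> measurable_fun D f ->
  (\int[mu]_(y in D) f y = \int[mu]_(x in phi @^-1` D) f (phi x))%E.
Proof.
move=> mD mf.
have ge0 (h : R -> \bar R) : measurable_fun D h -> (forall y, 0 <= h y)%E ->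
    (\int[mu]_(y in D) h y = \int[mu]_(x in phi @^-1` D) h (phi x))%E.
  move=> mh h0; rewrite -[RHS](ge0_integral_pushforward hphi.1 _ mD)//.
  apply: eq_measure_integral => [|? A mA _]; first exact: hphi.1.
  exact/esym/hphi.2.
rewrite integralE [RHS]integralE; congr (_ - _)%E.
- rewrite (ge0 f^\+%E)//; last exact: measurable_funepos.
  by apply: eq_integral => x _; rewrite !funeposE.
- rewrite (ge0 f^\-%E)//; last exact: measurable_funeneg.
  by apply: eq_integral => x _; rewrite !funenegE.
Qed.

Lemma preserving_Rintegral phi (hphi : measure_preserving phi)
    (D : set R) (f : R -> R) :
  measurable D -> measurable_fun D f ->
  \int[mu]_(y in D) f y = \int[mu]_(x in phi @^-1` D) f (phi x).
Proof.
move=> mD mf; rewrite /Rintegral (preserving_integral hphi)//.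
exact/measurable_EFinP.
Qed.

Lemma preserving_integrable phi (hphi : measure_preserving phi)
    (D : set R) (f : R -> R) :
  measurable D -> mu.-integrable D (EFin \o f) ->
  mu.-integrable (phi @^-1` D) (EFin \o (f \o phi)).
Proof.
move=> mD /integrableP[mf fi]; apply/integrableP; split.
  have mf' : measurable_fun D f by exact/measurable_EFinP.
  by apply/measurable_EFinP; exact: (preserving_measurable hphi mD mf').
by rewrite -(preserving_integral hphi (f := fun x => `|(f x)%:E|%E))//;
  exact: measurableT_comp.
Qed.

Lemma preserving_measurableS phi (hphi : measure_preserving phi)
    d (T : sigmaRingType d) (E D : set mR) (f : mR -> T) :
  measurable D -> E `<=` phi @^-1` D -> measurable_fun D f ->
  measurable_fun E (f \o phi).
Proof.
move=> mD ED mf; apply: measurable_funS ED (preserving_measurable hphi mD mf).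
exact: preserving_preimage.
Qed.

Lemma preimage_shift_itv (t x : R) :
  (fun y : mR => t + y : mR) @^-1` `]t, t + x[ = `]0, x[%classic.
Proof.
apply/seteqP; split=> y /=; rewrite !in_itv/=.
  by move=> /andP[? ?]; apply/andP; split; lra.
by move=> /andP[? ?]; apply/andP; split; lra.
Qed.

Lemma preimage_reflect_itv (t x : R) :
  (fun y : mR => t - y : mR) @^-1` `]t - x, t[ = `]0, x[%classic.
Proof.
apply/seteqP; split=> y /=; rewrite !in_itv/=.
  by move=> /andP[? ?]; apply/andP; split; lra.
by move=> /andP[? ?]; apply/andP; split; lra.
Qed.

Lemma ae_neq (a : R) : {ae mu, forall x, x != a}.
Proof.
exists [set a]; split; [exact: measurable_set1|exact: lebesgue_measure_set1|].
by move=> x /= /negP; rewrite negbK => /eqP.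
Qed.

(** Consecutive windows of length [L] leave out only the countable grid
    [a + L * n], which is negligible. *)
Lemma ae_windows (a L : R) (P : R -> Prop) : 0 < L ->
  (forall n : nat, {ae mu, forall x, a < x < a + L -> P (L * n%:R + x)}) ->
  {ae mu, forall s, a < s -> P s}.
Proof.
move=> L0 aeP.
have shifted : {ae mu, forall s, forall n, a < s - L * n%:R < a + L -> P s}.
  apply: ae_forall_nat => n.
  apply: aeS (preserving_ae (preserving_shift (- (L * n%:R))) (aeP n)) => s h.
  by rewrite addrC => /h; rewrite addrA subrr add0r.
have grid : {ae mu, forall s, forall n : nat, s != a + L * n%:R}.
  by apply: ae_forall_nat => n; exact: ae_neq.
apply: aeS2 shifted grid => s hP hne as_.
have q0 : 0 <= (s - a) / L by rewrite divr_ge0 ?subr_ge0// ltW.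
have /andP[n1 n2] := truncn_itv q0.
set n := Num.truncn _ in n1 n2.
apply: (hP n); apply/andP; split.
  rewrite ltrBrDr lt_neqAle eq_sym hne/=.
  by move: n1; rewrite ler_pdivlMr// => n1; rewrite mulrC -lerBrDl.
move: n2; rewrite ltr_pdivrMr// => n2.
by rewrite ltrBlDr -ltrBlDl opprD addrA -/(s - a); move: n2; rewrite -natr1; lra.
Qed.

Lemma ae_symmetric (P : R -> Prop) :
  {ae mu, forall s, 0 <= s <= 1 -> P (- s) /\ P s} ->
  {ae mu, forall s, -1 < s < 1 -> P s}.
Proof.
move=> aeP; apply: aeS2 aeP (preserving_ae (preserving_reflect 0) aeP) => s h1 h2.
move=> /andP[s1 s2]; have [s0|s0] := leP 0 s; first by case: h1 => //; lra.
by case: h2; [lra|rewrite sub0r opprK].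
Qed.

(** * Test functions approximating indicators of intervals *)

(** Differentiability from a quadratic error bound avoids a case analysis at the
    point where [sqpos] is only once differentiable. *)
Lemma is_derive_quadratic (f : R -> R) (x d C : R) :
  (forall h, `|f (h + x) - f x - d * h| <= C * h ^+ 2) -> is_derive x 1 f d.
Proof.
move=> fC.
have C0 : 0 <= C.
  by have := le_trans (normr_ge0 _) (fC 1); rewrite expr1n mulr1.
have cf : (fun h => h^-1 *: ((f \o shift x) (h *: 1) - f x)) @ 0^' --> d.
  apply/cvgrPdist_le => e e0; near=> h.
  have h0 : h != 0 by near: h; exact: nbhs_dnbhs_neq.
  rewrite distrC /= /GRing.scale/= mulr1.
  have -> : h^-1 * (f (h + x) - f x) - d = h^-1 * (f (h + x) - f x - d * h).
    by field.
  rewrite normrM normfV ler_pdivrMl ?normr_gt0//.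
  apply: (le_trans (fC h)); rewrite -(real_normK (num_real h)).
  have : `|h| <= e / (C + 1).
    near: h; apply: dnbhs0_le.
    by rewrite divr_gt0// ltr_wpDl.
  rewrite ler_pdivlMr ?ltr_wpDl// => he.
  rewrite expr2 mulrCA ler_wpM2l//.
  by apply: le_trans he; rewrite mulrDr mulr1 mulrC lerDl normr_ge0.
apply: DeriveDef; first by apply/cvg_ex; exists d.
exact: cvg_lim cf.
Unshelve. all: by end_near. Qed.

(** The square of the positive part: continuously differentiable, and nonzero
    exactly on the positive half-line. *)
Definition sqpos (x : R) : R := Num.max x 0 ^+ 2.

Lemma is_derive_sqpos (x : R) : is_derive x 1 sqpos (2 * Num.max x 0).
Proof.
apply: (@is_derive_quadratic _ _ _ 1) => h; rewrite /sqpos mul1r ler_norml.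
by rewrite /Num.max; case: ifP => h1; case: ifP => h2; nra.
Qed.

Lemma continuous_max0 : continuous (fun x : R => Num.max x 0).
Proof.
move=> x; apply: (@continuous_max _ _ (fun y => y) (cst 0)); first exact: cvg_id.
exact: cvg_cst.
Qed.

(** The polynomial [(x - a) * (b - x)] is positive exactly on [a < x < b], so
    composing it with [sqpos] and with [q |-> 1 - (1 + n * q)^-1] gives functions
    of class C^1 supported in [[a, b]], with values in [[0, 1]], that increase to
    the indicator of the open interval as [n] grows. *)
Definition bump (a b : R) (n : nat) (x : R) : R :=
  1 - (1 + n%:R * sqpos ((x - a) * (b - x)))^-1.

Lemma bump_den a b n (x : R) : 0 < 1 + n%:R * sqpos ((x - a) * (b - x)).
Proof. by rewrite ltr_pwDl// mulr_ge0// sqr_ge0. Qed.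

Definition dbump (a b : R) (n : nat) (x : R) : R :=
  (1 + n%:R * sqpos ((x - a) * (b - x))) ^- 2 *
  (n%:R * (2 * Num.max ((x - a) * (b - x)) 0 * (a + b - 2 * x))).

Lemma is_derive_bump a b n (x : R) : is_derive x 1 (bump a b n) (dbump a b n x).
Proof.
have q : is_derive x 1 (fun y : R => (y - a) * (b - y)) (a + b - 2 * x).
  by apply: is_derive_eq; rewrite /GRing.scale/=; ring.
have s := @is_derive1_comp _ sqpos (fun y => (y - a) * (b - y)) x _ _
  (is_derive_sqpos ((x - a) * (b - x))) q.
have i : is_derive x 1 (fun y => 1 + n%:R * sqpos ((y - a) * (b - y)))
   (n%:R * (2 * Num.max ((x - a) * (b - x)) 0 * (a + b - 2 * x))).
  have := is_deriveD (is_derive_cst (1 : R) x 1) (is_deriveZ n%:R s).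
  by rewrite add0r.
rewrite /bump /dbump.
have v := is_deriveV (f := fun y => 1 + n%:R * sqpos ((y - a) * (b - y)))
  (lt0r_neq0 (bump_den a b n x)) i.
have := is_deriveB (is_derive_cst (1 : R) x 1) v.
by rewrite /GRing.scale/= sub0r mulNr opprK.
Qed.

Lemma test_function_bump (a b : R) n :
  0 < a -> a <= b -> b < 1 -> test_function (bump a b n).
Proof.
move=> a0 ab b1; split.
- by move=> x; have := is_derive_bump a b n x; case.
- have -> : (bump a b n)^`()%classic = dbump a b n.
    apply/funext => x; rewrite derive1E.
    by have := is_derive_bump a b n x; case.
  have cq : continuous (fun x : R => (x - a) * (b - x)).
    move=> x; apply: cvgM; apply: cvgB; [exact: cvg_id|exact: cvg_cst|
      exact: cvg_cst|exact: cvg_id].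
  have cm : continuous (fun x : R => Num.max ((x - a) * (b - x)) 0).
    move=> x; apply: (continuous_comp (f := fun x : R => (x - a) * (b - x))
      (g := fun y : R => Num.max y 0)); [exact: cq|exact: continuous_max0].
  have cd : continuous (fun x : R => 1 + n%:R * sqpos ((x - a) * (b - x))).
    move=> x; apply: cvgD; first exact: cvg_cst.
    by apply: cvgM; [exact: cvg_cst|apply: cvgM; exact: cm].
  move=> x; apply: cvgM; last first.
    apply: cvgM; first exact: cvg_cst.
    apply: cvgM; first by apply: cvgM; [exact: cvg_cst|exact: cm].
    by apply: cvgB; [exact: cvg_cst|apply: cvgM; [exact: cvg_cst|exact: cvg_id]].
  apply: cvgV; first by rewrite expf_neq0// lt0r_neq0// bump_den.
  by apply: cvgM; exact: cd.
- exists a, b; split=> // x; apply: contraR => xab.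
  rewrite /bump /sqpos max_r ?expr0n/= ?mulr0 ?addr0 ?invr1 ?subrr//.
  by move: xab; rewrite negb_and -!ltNge => /orP[] ?; nra.
Qed.

Lemma bump_itv (a b : R) n (x : R) : 0 <= bump a b n x <= 1.
Proof.
have d1 : 1 <= 1 + n%:R * sqpos ((x - a) * (b - x)).
  by rewrite lerDl mulr_ge0// sqr_ge0.
rewrite /bump subr_ge0 invf_le1 ?(lt_le_trans ltr01 d1)// d1/=.
by rewrite gerBl invr_ge0 (le_trans ler01).
Qed.

Lemma bump_cvg (a b : R) (x : R) :
  a <= b -> bump a b n x @[n --> \oo] --> (\1_(`]a, b[%classic) x : R).
Proof.
move=> ab; rewrite indicE; case: (boolP (x \in `]a, b[%classic)) => xab.
  have q0 : 0 < sqpos ((x - a) * (b - x)).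
    move: xab; rewrite inE/= in_itv/= => /andP[ax xb].
    have ? : 0 < (x - a) * (b - x) by rewrite mulr_gt0// subr_gt0.
    by rewrite /sqpos max_l ?exprn_gt0// ltW.
  rewrite -[X in _ --> X]subr0; apply: cvgB; first exact: cvg_cst.
  apply/gtr0_cvgV0; first by apply: nearW => n; exact: bump_den.
  apply/cvgryPge => A; near=> n.
  apply: (@le_trans _ _ (n%:R * sqpos ((x - a) * (b - x)))); last by rewrite lerDr.
  by rewrite -ler_pdivrMr//; near: n; exact: nbhs_infty_ger.
rewrite /bump /sqpos max_r ?expr0n/=.
  by under eq_fun do rewrite mulr0 addr0 invr1 subrr; exact: cvg_cst.
move: xab; rewrite notin_setE/= in_itv/= => /negP; rewrite negb_and -!leNgt.
by move=> /orP[] ?; nra.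
Unshelve. all: by end_near. Qed.

(** * Weak derivatives *)

Lemma integrable_measurable (D : set mR) (w : R -> R) :
  mu.-integrable D (EFin \o w) -> measurable_fun D w.
Proof. by case/integrableP => /measurable_EFinP. Qed.

Lemma integrable_patch (D : set mR) (w : R -> R) : measurable D ->
  mu.-integrable D (EFin \o w) -> mu.-integrable setT (EFin \o (w \_ D)).
Proof.
by move=> mD /(integrable_mkcond (T := mR) (EFin \o w) mD); rewrite restrict_EFin.
Qed.

(** The primitive of [w] is locally constant, and by Lebesgue differentiation its
    derivative is [w] almost everywhere. *)
Lemma ae_eq0_itv_integrals (A B : R) (w : R -> R) :
  mu.-integrable `]A, B[ (EFin \o w) ->
  (forall a b, A < a -> a <= b -> b < B -> \int[mu]_(x in `]a, b[) w x = 0) ->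
  {ae mu, forall x, A < x < B -> w x = 0}.
Proof.
move=> iw w0.
pose f := w \_ `]A, B[.
have mAB : measurable (`]A, B[%classic : set mR) by exact: measurable_itv.
have iF : mu.-integrable setT (EFin \o f) by exact: integrable_patch.
have iFy y : mu.-integrable `]-oo, y] (EFin \o f) by apply: integrableS iF.
have := FTC1Ny iFy (integrable_locally mAB iw).
set F := fun x : R => _; apply: aeS => x [dF F'x] /andP[Ax xB].
suff FE : \forall y \near x, F y = cst (F x) y.
  have <- : f x = w x by rewrite /f patchE mem_set//= in_itv/= Ax xB.
  by rewrite -F'x derive1E (near_eq_derive _ FE) derive_cst.
have Fle a b : A < a -> a <= b -> b < B -> F b = F a.
  move=> Aa ab bB; apply/eqP; rewrite -subr_eq0; apply/eqP.
  rewrite /F (Rintegral_itvB (iFy b)) ?bnd_simp//.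
  rewrite -Rintegral_itv_bndo_bndc; last by apply: integrableS iF.
  rewrite -[RHS](w0 a b)//; apply: eq_Rintegral => t.
  rewrite inE/= in_itv/= => /andP[ta tb].
  by rewrite /f patchE mem_set//= in_itv/= (lt_trans Aa ta) (lt_trans tb bB).
near=> y.
have Ay : A < y by near: y; exact: lt_nbhsr.
have yB : y < B by near: y; exact: lt_nbhsl.
by case: (leP x y) => xy; [apply: Fle|apply/esym/Fle => //; exact: ltW].
Unshelve. all: by end_near. Qed.

Lemma integrable_mul_continuous (w h : R -> R) : continuous h ->
  mu.-integrable `]0, 1[ (EFin \o w) ->
  mu.-integrable `]0, 1[ (EFin \o (fun x => w x * h x)).
Proof.
move=> ch iw; have m01 : measurable (`]0, 1[%classic : set mR) by exact: measurable_itv.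
have bh : [bounded h x | x in `]0, 1[%classic : set R].
  have /compact_bounded [M [Mr hM]] : compact (h @` `[0, 1]).
    by apply: continuous_compact; [exact: continuous_subspaceT|exact: segment_compact].
  exists M; split=> // N MN x /= x01; apply: (hM _ MN); exists x => //.
  by move: x01; rewrite /= !in_itv/= => /andP[/ltW -> /ltW ->].
have mh : measurable_fun (`]0, 1[%classic : set mR) h.
  by apply: measurable_funTS; exact: continuous_measurable_fun.
exact: (integrableMl m01 iw mh bh).
Qed.

Lemma test_function_continuous (phi : R -> R) : test_function phi -> continuous phi.
Proof.
by case=> dphi _ _ x; exact/differentiable_continuous/derivable1_diffP/dphi.
Qed.

(** By dominated convergence along the bumps, the integrals of [w] over all
    compactly included intervals vanish. *)
Lemma du_bois_reymond (w : R -> R) : mu.-integrable `]0, 1[ (EFin \o w) ->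
  (forall phi, test_function phi -> \int[mu]_(x in `]0, 1[) (w x * phi x) = 0) ->
  {ae mu, forall x, 0 < x < 1 -> w x = 0}.
Proof.
move=> iw w0; apply: ae_eq0_itv_integrals => // a b a0 ab b1.
have m01 : measurable (`]0, 1[%classic : set mR) by exact: measurable_itv.
pose f_ n x := (w x * bump a b n x)%:E.
have tb n := test_function_bump n a0 ab b1.
have if_ n : mu.-integrable `]0, 1[ (f_ n).
  exact: integrable_mul_continuous (test_function_continuous (tb n)) iw.
have f_0 n : (\int[mu]_(x in `]0%R, 1%R[) f_ n x = 0)%E.
  rewrite -(fineK (integrable_fin_num m01 (if_ n))); congr EFin.
  exact: w0 _ (tb n).
pose l x := (w x * (\1_(`]a, b[%classic : set mR) x : R))%:E.
have mw : measurable_fun (`]0, 1[%classic : set mR) w by exact: integrable_measurable.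
have [||||_ _] := @dominated_convergence _ _ _ mu _ m01 f_ l (abse \o (EFin \o w))
  (fun n => measurable_int mu (if_ n)).
- by apply/measurable_EFinP/measurable_funM => //; exact: measurable_indic.
- apply: aeW => x _; apply: cvg_EFin; first exact: nearW.
  by apply: cvgM; [exact: cvg_cst|exact: bump_cvg].
- exact: integrable_abse.
- apply: aeW => x n _; rewrite /f_ /= lee_fin normrM ler_piMr//.
  by have /andP[b0 b1'] := bump_itv a b n x; rewrite ger0_norm.
rewrite [X in X @ _ --> _](_ : _ = cst 0%E); last by apply/funext => n; rewrite /= f_0.
move=> c; have l0 : 0%E = (\int[mu]_(x in `]0%R, 1%R[) l x)%E.
  by rewrite -(cvg_lim _ c)// lim_cst.
rewrite -[RHS](congr1 fine (esym l0)) -[LHS]/(Rintegral _ _ _) Rintegral_mkcond.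
rewrite [RHS]Rintegral_mkcond; congr Rintegral.
apply/funext => x; rewrite !patchE; case: ifPn => [xab|].
  rewrite mem_set; last first.
    by move: xab; rewrite inE/= !in_itv/= => /andP[? ?]; apply/andP; split; lra.
  by rewrite indicE xab mulr1.
by case: ifP => // _ /negbTE xab; rewrite indicE xab mulr0.
Qed.

Lemma integral_patch (D : set mR) (w : R -> R) :
  (\int[mu]_(x in D) (w x)%:E = \int[mu]_x ((w \_ D) x)%:E)%E.
Proof.
rewrite integral_mkcond; apply: eq_integral => x _.
by rewrite -[RHS]/((EFin \o (w \_ D)) x) -restrict_EFin.
Qed.

Lemma integral_derive1_test (phi : R -> R) (s : R) : test_function phi ->
  0 <= s -> s < 1 ->
  (\int[mu]_(x in `]s, 1%R[) (phi^`()%classic x)%:E = (- phi s)%:E)%E.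
Proof.
move=> tphi s0 s1; have cphi := test_function_continuous tphi.
case: (tphi) => dphi cdphi [a [b [a0 b1 supp]]].
have phi1 : phi 1 = 0.
  by apply/eqP; apply: contraTT isT => /supp /andP[_]; rewrite leNgt b1.
have md D : measurable_fun (D : set mR) (fun x => (phi^`()%classic x)%:E).
  by apply/measurable_EFinP; apply: measurable_funTS; exact: continuous_measurable_fun.
rewrite (integral_itv_bndo_bndc (md _)) (integral_itv_obnd_cbnd (md _)).
have -> := @continuous_FTC2 R phi^`()%classic phi s 1 s1 _ _ (fun x _ => erefl).
- by rewrite phi1 sub0e.
- exact: continuous_subspaceT.
- split=> [x _||]; first exact: dphi.
  + exact/cvg_at_right_filter/cphi.
  + exact/cvg_at_left_filter/cphi.
Qed.

Lemma integrable_cst (D : set mR) (c : R) : measurable D -> (mu D < +oo)%E ->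
  mu.-integrable D (EFin \o cst c).
Proof.
move=> mD Doo; apply/integrableP; split; first exact/measurable_EFinP/measurable_cst.
by rewrite /= integral_cst//=; apply: lte_mul_pinfty.
Qed.

Lemma integrable_cst01 (c : R) : mu.-integrable `]0, 1[ (EFin \o cst c).
Proof.
apply: integrable_cst => //.
by rewrite [ltLHS]lebesgue_measure_itv/= lte_fin ltr01 sube0 ltry.
Qed.

(** Integration by parts for a primitive of an L^1 function: exchange the order
    of integration in the double integral of [phi' x * w s] over [0 < s < x < 1];
    the inner integral of [phi'] over [(s, 1)] is [- phi s]. *)
Lemma primitive_test (w phi : R -> R) :
  mu.-integrable `]0, 1[ (EFin \o w) -> test_function phi ->
  let P x := \int[mu]_(s in `]0, x[) w s in
  mu.-integrable `]0, 1[ (EFin \o (fun x => P x * phi^`()%classic x)) /\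
  \int[mu]_(x in `]0, 1[) (P x * phi^`()%classic x) =
  - \int[mu]_(x in `]0, 1[) (w x * phi x).
Proof.
move=> iw tphi P; case: (tphi) => dphi cdphi _.
have m01 : measurable (`]0, 1[%classic : set mR) by exact: measurable_itv.
have ipsi : mu.-integrable `]0, 1[ (EFin \o phi^`()%classic).
  have := integrable_mul_continuous cdphi (integrable_cst01 1).
  by apply: eq_integrable => // x _ /=; rewrite mul1r.
pose a := phi^`()%classic \_ `]0, 1[.
pose b := w \_ `]0, 1[.
have ia : mu.-integrable setT (EFin \o a) by exact: integrable_patch.
have ib : mu.-integrable setT (EFin \o b) by exact: integrable_patch.
(* The domain [s < x] of the double integral is carried by the integrand. *)
pose k (z : mR * mR) : \bar R := if z.2 < z.1 then (a z.1 * b z.2)%:E else 0%E.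
have ma : measurable_fun setT (a : mR -> R) := integrable_measurable ia.
have mb : measurable_fun setT (b : mR -> R) := integrable_measurable ib.
have mab : measurable_fun setT (fun z : mR * mR => (a z.1 * b z.2)%:E).
  apply/measurable_EFinP.
  by apply: measurable_funM; [exact: measurableT_comp ma _|exact: measurableT_comp mb _].
have mk : measurable_fun setT k.
  by apply: measurable_fun_ifT => //; exact: measurable_fun_ltr.
have iab : (mu \x mu)%E.-integrable setT (fun z : mR * mR => (a z.1 * b z.2)%:E).
  apply/(integrable12ltyP _ _ mab).
  have [_ iaoo] := integrableP _ _ _ ia; have [_ iboo] := integrableP _ _ _ ib.
  have mna : measurable_fun setT (fun x : mR => `|(a x)%:E|%E).
    by apply: measurableT_comp => //; exact/measurable_EFinP.
  have mnb : measurable_fun setT (fun x : mR => `|(b x)%:E|%E).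
    by apply: measurableT_comp => //; exact/measurable_EFinP.
  rewrite (eq_integral (fun x : mR => `|(a x)%:E| * \int[mu]_y `|(b y)%:E|)%E); last first.
    move=> x _; rewrite -ge0_integralZl//.
    by apply: eq_integral => y _; rewrite /= normrM EFinM.
  rewrite ge0_integralZr//; last exact: integral_ge0.
  by rewrite lte_mul_pinfty// ?integral_ge0// ge0_fin_numE// integral_ge0.
have ik : (mu \x mu)%E.-integrable setT k.
  apply: (le_integrable _ mk _ iab) => // z _.
  by rewrite /k; case: ifP => // _; rewrite abse0.
have in1 x : (\int[mu]_y k (x, y) =
    (((fun x => P x * phi^`()%classic x) \_ `]0%R, 1%R[) x)%:E)%E.
  rewrite patchE; case: ifPn => [|/negbTE xD]; last first.
    by rewrite integral0_eq// => y _; rewrite /k/= /a patchE xD mul0r if_same.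
  rewrite inE/= in_itv/= => /andP[x0 x1].
  have iwx : mu.-integrable `]0, x[ (EFin \o w).
    apply: integrableS iw => // y /=; rewrite !in_itv/= => /andP[-> /lt_trans]; exact.
  transitivity (\int[mu]_y ((phi^`()%classic x)%:E * ((w \_ `]0, x[) y)%:E))%E.
    apply: eq_integral => y _; rewrite /k/= /a /b !patchE !mem_setE !in_itv/= x0 x1/=.
    case: (ltP y x) => yx; last by rewrite andbF mule0.
    by rewrite (lt_trans yx x1) !andbT; case: ifP => _; rewrite -EFinM.
  rewrite integralZl//; last exact: integrable_patch.
  rewrite EFinM muleC; congr (_ * _)%E.
  by rewrite -integral_patch fineK//; exact: integrable_fin_num.
have in2 y : (\int[mu]_x k (x, y) =
    (- ((fun y => w y * phi y) \_ `]0%R, 1%R[) y)%:E)%E.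
  rewrite patchE; case: ifPn => [|/negbTE yD]; last first.
    by rewrite integral0_eq ?oppr0// => x _; rewrite /k/= /b patchE yD mulr0 if_same.
  rewrite inE/= in_itv/= => /andP[y0 y1].
  have iphi : mu.-integrable `]y, 1[ (EFin \o phi^`()%classic).
    apply: integrableS ipsi => // x /=; rewrite !in_itv/= => /andP[/(lt_trans y0) -> ->].
    by [].
  transitivity (\int[mu]_x ((w y)%:E * ((phi^`()%classic \_ `]y, 1[) x)%:E))%E.
    apply: eq_integral => x _; rewrite /k/= /a /b !patchE !mem_setE !in_itv/= y0 y1/=.
    case: (ltP y x) => yx; last by rewrite mule0.
    by rewrite (lt_trans y0 yx)/=; case: ifP => _; rewrite -EFinM mulrC.
  rewrite integralZl//; last exact: integrable_patch.
  rewrite -integral_patch integral_derive1_test// ?ltW//.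
  by rewrite -EFinM mulrN.
have iP : mu.-integrable `]0, 1[ (EFin \o (fun x => P x * phi^`()%classic x)).
  apply/(integrable_mkcond (T := mR) _ m01); rewrite restrict_EFin.
  by apply: eq_integrable (integrable_fubini_F ik) => // x _; exact: in1.
split=> //.
have iwphi := integrable_mul_continuous (test_function_continuous tphi) iw.
rewrite [LHS]Rintegral_mkcond [X in _ = - X]Rintegral_mkcond /Rintegral -fineN.
congr fine; rewrite -integralN; last first.
  by apply: integrable_add_def => //; exact: integrable_patch.
rewrite -(eq_integral _ _ (fun x _ => in1 x)) (Fubini ik).
by apply: eq_integral => y _; rewrite in2 EFinN.
Qed.

Lemma Rintegral_ae_eq (D : set mR) (u v : R -> R) : measurable D ->
  measurable_fun D u -> measurable_fun D v ->
  {ae mu, forall x, D x -> u x = v x} ->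
  \int[mu]_(x in D) u x = \int[mu]_(x in D) v x.
Proof.
move=> mD mU mv uv; congr fine; apply: ae_eq_integral => //.
- exact/measurable_EFinP.
- exact/measurable_EFinP.
- by apply: aeS uv => x /[apply] ->.
Qed.

Lemma is_weak_derivative_primitive (u w : R -> R) (C : R) :
  measurable_fun (`]0, 1[%classic : set mR) u ->
  mu.-integrable `]0, 1[ (EFin \o w) ->
  {ae mu, forall x, 0 < x < 1 -> u x = C + \int[mu]_(s in `]0, x[) w s} ->
  is_weak_derivative u w.
Proof.
move=> mU iw uE; split=> // phi tphi; case: (tphi) => dphi cdphi _.
have m01 : measurable (`]0, 1[%classic : set mR) by exact: measurable_itv.
have [iP PE] := primitive_test iw tphi.
have mdphi : measurable_fun (`]0, 1[%classic : set mR) phi^`()%classic.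
  by apply: measurable_funTS; exact: continuous_measurable_fun.
have iC c : mu.-integrable `]0, 1[ (EFin \o (fun x => c * phi^`()%classic x)).
  exact: (integrable_mul_continuous (w := cst c) cdphi (integrable_cst01 c)).
have phi0 : phi 0 = 0.
  case: tphi => _ _ [a [b [a0 _ supp]]].
  by apply/eqP; apply: contraTT isT => /supp /andP[]; rewrite leNgt a0.
rewrite (@Rintegral_ae_eq _ _ (fun x => C * phi^`()%classic x +
    (\int[mu]_(s in `]0, x[) w s) * phi^`()%classic x))//.
- rewrite RintegralD// PE -[RHS]add0r; congr (_ + _).
  rewrite RintegralZl//; last first.
    by apply: eq_integrable (iC 1) => // x _; rewrite /= mul1r.
  by rewrite /Rintegral integral_derive1_test//= phi0 oppr0 mulr0.
- exact: measurable_funM.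
- by apply: measurable_funD; exact: integrable_measurable.
- by apply: aeS uE => x h /=; rewrite in_itv/= => /h ->; rewrite mulrDl.
Qed.

(** The representative chosen by [weak_derivative] is known only through the
    uniqueness of the weak derivative. *)
Lemma weak_derivative_unique (u w : R -> R) : is_weak_derivative u w ->
  mu.-integrable `]0, 1[ (EFin \o weak_derivative u) /\
  {ae mu, forall x, 0 < x < 1 -> weak_derivative u x = w x}.
Proof.
move=> uw; have [iv uv] : is_weak_derivative u (weak_derivative u).
  by apply: (@getPex _ (is_weak_derivative u)); exists w.
case: uw => iw uw; split=> //.
have m01 : measurable (`]0, 1[%classic : set mR) by exact: measurable_itv.
have ivw : mu.-integrable `]0, 1[ (EFin \o (fun x => weak_derivative u x - w x)).
  by have := integrableB m01 iv iw; apply: eq_integrable.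
apply: aeS (du_bois_reymond ivw _) => [x h /h /eqP|phi tphi].
  by rewrite subr_eq0 => /eqP.
have cphi := test_function_continuous tphi.
under eq_Rintegral do rewrite mulrBl.
rewrite RintegralB//; [|exact: integrable_mul_continuous..].
have := uv _ tphi; rewrite uw// => /oppr_inj ->; exact: subrr.
Qed.

Lemma measurable_primitive (w : R -> R) : mu.-integrable `]0, 1[ (EFin \o w) ->
  measurable_fun (`]0, 1[%classic : set mR) (fun x => \int[mu]_(s in `]0, x[) w s).
Proof.
move=> iw; have m01 : measurable (`]0, 1[%classic : set mR) by exact: measurable_itv.
pose W := w \_ `]0, 1[.
have iW (D : set mR) : measurable D -> mu.-integrable D (EFin \o W).
  by move=> mD; apply: integrableS (integrable_patch m01 iw).
pose Q x := \int[mu]_(s in `[0, x]) W s.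
have cQ : {within `[0, 1], continuous Q}.
  by apply: parameterized_integral_continuous => //; apply: iW.
have mQ : measurable_fun (`]0, 1[%classic : set mR) Q.
  have m : measurable_fun (`[0, 1]%classic : set R) Q.
    exact: (subspace_continuous_measurable_fun _ cQ).
  by apply: measurable_funS m => // x /=; rewrite !in_itv/= => /andP[/ltW -> /ltW ->].
apply: eq_measurable_fun mQ => x; rewrite inE/= in_itv/= => /andP[x0 x1].
rewrite /Q -Rintegral_itv_obnd_cbnd; last by apply: iW.
rewrite -Rintegral_itv_bndo_bndc; last by apply: iW.
apply: eq_Rintegral => s; rewrite inE/= in_itv/= => /andP[s0 sx].
by rewrite /W patchE mem_set//= in_itv/= s0 (lt_trans sx x1).
Qed.

(** * Integrability on bounded intervals *)

Lemma mu_setT_gt0 : (0 < mu [set: mR])%E.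
Proof.
apply: (@lt_le_trans _ _ (mu `]0, 1[)).
  by rewrite [ltRHS]lebesgue_measure_itv/= lte_fin ltr01 sube0 lte_fin ltr01.
by apply: le_measure; rewrite ?inE//; exact: measurable_itv.
Qed.

Lemma inLp_oo_bound (D : set mR) (f : R -> R) : inLp +oo D f ->
  exists M : R, {ae mu, forall x, D x -> `|f x| <= M}.
Proof.
move=> fD; have : finite_norm mu +oo (f \_ D).
  by have := sub_Lfun_finLfun fD; rewrite inE.
rewrite /finite_norm unlock mu_setT_gt0 => fin.
pose F : mR -> \bar R := abse \o (EFin \o f \_ D).
have F0 : (0 <= ess_sup mu F)%E.
  by apply: ess_sup_gee; [exact: mu_setT_gt0|apply: aeW => x; exact: abse_ge0].
exists (fine (ess_sup mu F)); apply: aeS (ess_sup_ge mu F) => x /= + Dx.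
rewrite /F /= patchE mem_set// => xF.
by rewrite -lee_fin fineK// ge0_fin_numE.
Qed.

Lemma ae_le_integrable (D : set mR) (f g : R -> R) : measurable D ->
  measurable_fun D f -> mu.-integrable D (EFin \o g) ->
  {ae mu, forall x, D x -> `|f x| <= g x} -> mu.-integrable D (EFin \o f).
Proof.
move=> mD mf ig fg; apply/integrableP; split; first exact/measurable_EFinP.
have [mg goo] := integrableP _ _ _ ig; apply: le_lt_trans goo.
apply: ae_ge0_le_integral => //.
- by apply: measurableT_comp => //; exact/measurable_EFinP.
- by apply: measurableT_comp.
by apply: aeS fg => x /[apply] /= h; rewrite lee_fin (le_trans h)// ler_norm.
Qed.

Lemma inLp_measurable (p : \bar R) (D : set mR) (f : R -> R) :
  measurable D -> inLp p D f -> measurable_fun D f.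
Proof.
move=> mD fp; apply/(measurable_restrictT _ mD).
by have := sub_Lfun_mfun fp; rewrite inE.
Qed.

Lemma inLp_integrable_powR (r : R) (D : set mR) (f : R -> R) :
  measurable D -> 1 <= r -> inLp r%:E D f ->
  mu.-integrable D (EFin \o (fun x => `|f x| `^ r)).
Proof.
move=> mD r1 fp; have ir := Lfun_integrable r1 fp.
have : mu.-integrable D (fun x => (`|(f \_ D) x| `^ r)%:E).
  by apply: integrableS ir.
by apply: eq_integrable => // x xD; rewrite /= patchE xD.
Qed.

(** On a set of finite measure L^p is contained in L^1, since
    [`|a| <= 1 + `|a| `^ r]. *)
Lemma inLp_integrable (p : \bar R) (D : set mR) (f : R -> R) :
  measurable D -> (mu D < +oo)%E -> (1 <= p)%E -> inLp p D f ->
  mu.-integrable D (EFin \o f).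
Proof.
move=> mD Doo p1 fp; have mf := inLp_measurable mD fp.
case: p p1 fp => [r| |//]; last first.
  move=> _ /inLp_oo_bound[M fM].
  exact: ae_le_integrable (integrable_cst M mD Doo) fM.
rewrite lee_fin => r1 fp; have ir := inLp_integrable_powR mD r1 fp.
have i1 : mu.-integrable D (EFin \o (fun x => 1 + `|f x| `^ r)).
  exact: (integrableD mD (integrable_cst 1 mD Doo) ir).
apply: ae_le_integrable i1 _ => //; apply: aeW => x Dx.
have [f1|f1] := leP `|f x| 1; first by rewrite (le_trans f1)// lerDl powR_ge0.
rewrite ler_wpDl// -[leLHS]powRr1//.
by rewrite ler_powR// ltW.
Qed.

Section LocallyIntegrable.
Variables (A : R) (g : R -> R).
Hypothesis ig : forall T, mu.-integrable `]A, T[ (EFin \o g).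

Lemma integrable_sub_itv (a b : R) : A <= a -> mu.-integrable `]a, b[ (EFin \o g).
Proof.
move=> Aa; apply: integrableS (ig b) => // x /=; rewrite !in_itv/= => /andP[+ ->].
by move=> /(le_lt_trans Aa) ->.
Qed.

Lemma Rintegral_chasles (a b c : R) : A <= a -> a <= b -> b <= c ->
  \int[mu]_(x in `]a, c[) g x =
  \int[mu]_(x in `]a, b[) g x + \int[mu]_(x in `]b, c[) g x.
Proof.
move=> Aa ab; rewrite le_eqVlt => /predU1P[<-|bc].
  by rewrite [in X in _ + X]set_itv_ge ?bnd_simp ?ltxx// Rintegral_set0 addr0.
rewrite -(Rintegral_itvB (integrable_sub_itv c Aa) (x := b)) ?bnd_simp//.
rewrite -Rintegral_itv_bndo_bndc; last exact: integrable_sub_itv.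
by rewrite addrC subrK.
Qed.

Lemma ointegral_sub (x y : R) : A <= 0 -> A <= x -> x <= y ->
  ointegral g 0 y - ointegral g 0 x = \int[mu]_(s in `]x, y[) g s.
Proof.
move=> A0 Ax xy.
have E z : A <= z -> ointegral g 0 z =
    \int[mu]_(s in `]A, z[) g s - \int[mu]_(s in `]A, 0[) g s.
  rewrite /ointegral; have [z0|z0] := leP 0 z => Az.
    by rewrite (@Rintegral_chasles A 0 z)// addrC addKr.
  by rewrite (@Rintegral_chasles A z 0)// ?ltW// opprD addNKr.
rewrite !E ?(le_trans Ax)//; rewrite (@Rintegral_chasles A x y)//; ring.
Qed.

Lemma Rintegral_shift (t x : R) : A <= t ->
  \int[mu]_(s in `]t, t + x[) g s = \int[mu]_(y in `]0, x[) g (t + y).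
Proof.
move=> At; rewrite -(preimage_shift_itv t).
apply: (preserving_Rintegral (preserving_shift t)); first exact: measurable_itv.
by apply: integrable_measurable; exact: integrable_sub_itv.
Qed.

Lemma Rintegral_reflect (t x : R) : A <= t - x ->
  \int[mu]_(s in `]t - x, t[) g s = \int[mu]_(y in `]0, x[) g (t - y).
Proof.
move=> At; rewrite -(preimage_reflect_itv t).
apply: (preserving_Rintegral (preserving_reflect t)); first exact: measurable_itv.
by apply: integrable_measurable; exact: integrable_sub_itv.
Qed.

Lemma integrable_shift (t x : R) : A <= t ->
  mu.-integrable `]0, x[ (EFin \o (fun y => g (t + y))).
Proof.
move=> At; rewrite -(preimage_shift_itv t).
apply: (preserving_integrable (preserving_shift t)); first exact: measurable_itv.
exact: integrable_sub_itv.
Qed.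

Lemma integrable_reflect (t x : R) : A <= t - x ->
  mu.-integrable `]0, x[ (EFin \o (fun y => g (t - y))).
Proof.
move=> At; rewrite -(preimage_reflect_itv t).
apply: (preserving_integrable (preserving_reflect t)); first exact: measurable_itv.
exact: integrable_sub_itv.
Qed.

Lemma ointegral_shift (t x : R) : A <= 0 -> A <= t -> 0 <= x ->
  ointegral g 0 (t + x) = ointegral g 0 t + \int[mu]_(y in `]0, x[) g (t + y).
Proof.
move=> A0 At x0; rewrite -[LHS](subrK (ointegral g 0 t)) ointegral_sub ?lerDl//.
by rewrite Rintegral_shift// addrC.
Qed.

End LocallyIntegrable.

(** * The d'Alembert representation *)

Lemma inLploc_integrable (p : \bar R) (a T : R) (f : R -> R) :
  (1 <= p)%E -> inLploc p a f -> mu.-integrable `]a, T[ (EFin \o f).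
Proof.
move=> p1 [mf lf]; have [aT|Ta] := ltP a T.
  apply: (inLp_integrable _ _ p1 (lf _ aT)) => //.
  by rewrite [ltLHS]lebesgue_measure_itv/= lte_fin aT -EFinB ltry.
by rewrite set_itv_ge ?bnd_simp -?leNgt//; exact: integrable_set0.
Qed.

(** The values at time [t] of the space and time derivatives of the solution,
    written with [g] alone: the condition at [x = 0] forces [f = - g]. *)
Definition profile_x (g : R -> R) (t y : R) : R :=
  - (g (t + y) + g (t - y)) / Num.sqrt 2.

Definition profile_t (g : R -> R) (t y : R) : R :=
  (g (t - y) - g (t + y)) / Num.sqrt 2.

Lemma integrable_profile_x (g : R -> R) (t x : R) :
  (forall T, mu.-integrable `]-1, T[ (EFin \o g)) -> 0 <= t -> x <= 1 ->
  mu.-integrable `]0, x[ (EFin \o profile_x g t).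
Proof.
move=> ig t0 x1.
have m : measurable (`]0, x[%classic : set mR) by exact: measurable_itv.
have i1 : mu.-integrable `]0, x[ (EFin \o (fun y => g (t + y))).
  by apply: (integrable_shift ig); lra.
have i2 : mu.-integrable `]0, x[ (EFin \o (fun y => g (t - y))).
  by apply: (integrable_reflect ig); lra.
have := integrableZl m (- (Num.sqrt 2)^-1) (integrableD m i1 i2).
by apply: eq_integrable => // y _ /=; rewrite /profile_x -EFinM; congr EFin; ring.
Qed.

Section Solution.
Variables (p : \bar R) (Sigma : set (R * R)) (U : @state R).
Variables (z : R -> R -> R) (f g : R -> R).
Hypotheses (p1 : (1 <= p)%E) (hz : wave_solution p Sigma U z f g).

Lemma wave_integrable_f (T : R) : mu.-integrable `]0, T[ (EFin \o f).
Proof. by case: hz => [[hf hg] _ _ _]; exact: inLploc_integrable hf. Qed.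

Lemma wave_integrable_g (T : R) : mu.-integrable `]-1, T[ (EFin \o g).
Proof. by case: hz => [[hf hg] _ _ _]; exact: inLploc_integrable hg. Qed.

Let wave_integrable_g0 (T : R) : mu.-integrable `]0, T[ (EFin \o g).
Proof. by apply: (integrable_sub_itv wave_integrable_g); lra. Qed.

(** On each window [(n, n + 1)] the constant 0 agrees almost everywhere with
    [z _ 0], a primitive of [(f + g) / sqrt 2]; uniqueness of weak derivatives
    identifies this integrand with 0. *)
Lemma wave_f_oppg : {ae mu, forall s, 0 < s -> f s = - g s}.
Proof.
apply: (@ae_windows 0 1) => // n; rewrite mul1r add0r.
have [_ zE bc _] := hz.
have m01 : measurable (`]0, 1[%classic : set mR) by exact: measurable_itv.
have n0 : 0 <= n%:R :> R by [].
have ifn x := integrable_shift wave_integrable_f x n0.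
have ign x := integrable_shift wave_integrable_g0 x n0.
pose w y := (Num.sqrt 2)^-1 * (f (n%:R + y) + g (n%:R + y)).
have iw : mu.-integrable `]0, 1[ (EFin \o w).
  by have := integrableZl m01 (Num.sqrt 2)^-1 (integrableD m01 (ifn 1) (ign 1));
    apply: eq_integrable.
have w1 : is_weak_derivative (cst 0) w.
  apply: (@is_weak_derivative_primitive _ _ (z n%:R 0)) => //.
  apply: aeS (preserving_ae (preserving_shift n%:R) bc) => x + /andP[x0 x1].
  case; first by rewrite addr_ge0// ltW.
  move=> zn _; rewrite -[LHS]zn !zE ?lexx ?ler01 ?addr_ge0// ?(ltW x0)//.
  rewrite !addr0 !subr0 (ointegral_shift wave_integrable_f) ?(ltW x0)//.
  rewrite (ointegral_shift wave_integrable_g0) ?(ltW x0)//.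
  rewrite /w RintegralZl// ?RintegralD//.
  - ring.
  - by have := integrableD _ (ifn x) (ign x); apply.
have w0 : is_weak_derivative (cst 0) (cst 0 : R -> R).
  apply: (@is_weak_derivative_primitive _ _ 0) => //; first exact: integrable_cst01.
  by apply: aeW => x _; rewrite add0r /Rintegral integral0_eq.
apply: aeS2 (weak_derivative_unique w1).2 (weak_derivative_unique w0).2 => x h1 h0 x01.
have := h1 x01; rewrite h0// => /esym/eqP; rewrite /w mulf_eq0 invr_eq0 sqrtr_eq0.
by rewrite leNgt ltr0n/= addr_eq0 => /eqP.
Qed.

Lemma wave_profile (t x : R) : 0 <= t -> 0 <= x <= 1 ->
  z t x = \int[mu]_(y in `]0, x[) profile_x g t y.
Proof.
move=> t0 x01; have [_ zE _ _] := hz; rewrite zE//; case/andP: x01 => x0 x1.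
have itx : mu.-integrable `]0, (t + x)[ (EFin \o g) := wave_integrable_g0 (t + x).
have m : measurable (`]0, x[%classic : set mR) by exact: measurable_itv.
have -> : ointegral f 0 (t + x) = - ointegral g 0 (t + x).
  have ifx := wave_integrable_f (t + x).
  have mtx : measurable (`]0, t + x[%classic : set mR) by exact: measurable_itv.
  rewrite /ointegral addr_ge0// -mulN1r -(RintegralZl (-1) mtx itx).
  apply: Rintegral_ae_eq => //.
  - exact: integrable_measurable.
  - by apply: measurable_funM => //; exact: integrable_measurable.
  - by apply: aeS wave_f_oppg => y fg /=; rewrite in_itv/= mulN1r => /andP[/fg].
have ig := wave_integrable_g.
have igs : mu.-integrable `]0, x[ (EFin \o (fun y => g (t + y))).
  by apply: (integrable_shift ig); lra.
have igr : mu.-integrable `]0, x[ (EFin \o (fun y => g (t - y))).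
  by apply: (integrable_reflect ig); lra.
rewrite mulrN addrC -mulrBr -opprB mulrN (ointegral_sub ig); [|lra..].
rewrite (Rintegral_chasles ig (b := t)); [|lra..].
rewrite (Rintegral_reflect ig) ?(Rintegral_shift ig); [|lra..].
rewrite -RintegralD// -mulNr -RintegralZl//.
- by apply: eq_Rintegral => y _; rewrite /profile_x; ring.
- by have := integrableD m igr igs; apply: eq_integrable.
Qed.

Lemma wave_t_profile (t : R) : 0 <= t ->
  {ae mu, forall x, 0 < x < 1 -> wave_t f g t x = profile_t g t x}.
Proof.
move=> t0; apply: aeS (preserving_ae (preserving_shift t) wave_f_oppg).
by move=> x h /andP[x0 _]; rewrite /wave_t /profile_t h ?ltr_wpDl// addrC.
Qed.

End Solution.

Lemma measurable_wave_t (p : \bar R) (Sigma : set (R * R)) U z f g (t : R) :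
  wave_solution p Sigma U z f g -> 0 <= t ->
  measurable_fun (`]0, 1[%classic : set mR) (wave_t f g t).
Proof.
move=> [[[mf _] [mg _]] _ _ _] t0.
have m0y : measurable (`]0, +oo[%classic : set mR) by exact: measurable_itv.
have m1y : measurable (`]-1, +oo[%classic : set mR) by exact: measurable_itv.
apply: measurable_funM => //; apply: measurable_funD.
  apply: (preserving_measurableS (preserving_shift t) m0y _ mf) => s /=.
  by rewrite !in_itv/= andbT => /andP[s1 _]; lra.
apply: (preserving_measurableS (preserving_reflect t) m1y _ mg) => s /=.
by rewrite !in_itv/= andbT => /andP[_ s1]; lra.
Qed.

(** * The boundary map *)

(** A value [a] of [g] that reaches [x = 1] is reflected there according to
    [Sigma], then at [x = 0], and re-enters as [fold a] after a time 2. *)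
Definition fold (a : R) : R :=
  if 1 < a then 2 - a else if a < -1 then - 2 - a else a.

(** The number of applications of [fold] that bring [a] into [[-1, 1]], plus one
    when [`|a|] is an odd integer. *)
Definition nfold (a : R) : int := Num.floor ((`|a| + 1) / 2).

(** The pointwise formula of [ginf]; it is the eventual value of the iterates of
    [fold]. *)
Definition fold_limit (a : R) : R :=
  (-1) ^ nfold a * (a / `|a|) * (`|a| - 2 * (nfold a)%:~R).

Lemma fold_id (a : R) : `|a| <= 1 -> fold a = a.
Proof.
by rewrite ler_norml /fold => /andP[a1 a2]; rewrite !ltNge a1 a2.
Qed.

Lemma norm_fold (a : R) : `|fold a| <= Num.max 1 (`|a| - 2).
Proof.
rewrite /fold le_max; case: ifPn => [a1|]; last case: ifPn => [a1 _|].
- rewrite (gtr0_norm (lt_trans ltr01 a1)); have [a2|a2] := leP a 2.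
    by rewrite ger0_norm ?subr_ge0//; apply/orP; left; lra.
  by rewrite ltr0_norm ?subr_lt0// opprB lexx orbT.
- rewrite (ltr0_norm (_ : a < 0)); last lra.
  have [a2|a2] := leP (-2) a.
    by rewrite ler0_norm; [apply/orP; left; lra|lra].
  by rewrite gtr0_norm; [apply/orP; right; lra|lra].
- by rewrite -!leNgt => ? ?; rewrite ler_norml; apply/orP; left; apply/andP.
Qed.

Lemma norm_fold_le (a : R) : `|fold a| <= `|a|.
Proof.
have [a1|a1] := leP `|a| 1; first by rewrite fold_id.
by apply: le_trans (norm_fold a) _; rewrite ge_max ltW//=; lra.
Qed.

Lemma fold_limit_small (a : R) : `|a| <= 1 -> fold_limit a = a.
Proof.
rewrite le_eqVlt => /orP[/eqP a1|a1]; rewrite /fold_limit /nfold.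
  have -> : Num.floor ((`|a| + 1) / 2) = 1.
    by apply: floor_def; rewrite a1; lra.
  by rewrite a1 expr1z divr1; ring.
have -> : Num.floor ((`|a| + 1) / 2) = 0.
  apply: floor_def; have := normr_ge0 a; lra.
rewrite mulr0 subr0 expr0z mul1r; have [->|a0] := eqVneq a 0; first by rewrite !mul0r.
by rewrite divfK// normr_eq0.
Qed.

(** If [2 < `|a|], then [fold] changes the sign of [a] and decreases [`|a|] by 2
    and [nfold a] by 1. If [1 < `|a| < 2], then [fold a] is already the limit, and
    if [`|a| = 2] both sides vanish. *)
Lemma fold_limit_fold (a : R) : fold_limit (fold a) = fold_limit a.
Proof.
have [a1|a1] := leP `|a| 1; first by rewrite fold_id.
have sg : fold a = - (a / `|a|) * (`|a| - 2).
  rewrite /fold; have [a0|a0] := leP 0 a.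
    rewrite ger0_norm// in a1 *; rewrite a1 divff; last lra.
    by ring.
  rewrite ltr0_norm// in a1 *; have -> : (1 < a) = false by lra.
  have -> : a < -1 by lra.
  by rewrite invrN mulrN divff; [ring|lra].
have [a2|a2] := ltP `|a| 2.
  rewrite fold_limit_small; last first.
    by apply: le_trans (norm_fold a) _; rewrite ge_max lexx/=; lra.
  rewrite sg /fold_limit /nfold.
  have -> : Num.floor ((`|a| + 1) / 2) = 1 by apply: floor_def; lra.
  by rewrite expr1z; ring.
have [b0|b0] := eqVneq `|a| 2.
  rewrite /fold_limit sg b0 subrr mulr0 mul0r mulr0 mul0r /nfold b0.
  have -> : Num.floor ((2 + 1) / 2 : R) = 1 by apply: floor_def; lra.
  by rewrite mulr1 subrr mulr0.
have an : `|a / `|a| | = 1 by rewrite normrM normfV normr_id divff//; lra.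
have bn : `|fold a| = `|a| - 2.
  by rewrite sg normrM normrN an mul1r ger0_norm//; lra.
have kE : nfold (fold a) = nfold a - 1.
  rewrite /nfold bn; have -> : (`|a| - 2 + 1) / 2 = (`|a| + 1) / 2 + (-1)%:~R by field.
  by rewrite floorDrz ?intr_int//= intrKfloor.
rewrite /fold_limit bn kE expfzDr// sg mulrK; last by rewrite unitfE; lra.
have -> : (-1 : R) ^ (-1) = -1 by rewrite exprN1 invrN1.
by rewrite intrB; ring.
Qed.

Lemma norm_iter_fold (n : nat) (a : R) :
  `|a| <= 2 * n%:R + 1 -> `|iter n fold a| <= 1.
Proof.
elim: n a => [|n IHn] a; first by rewrite mulr0 add0r.
rewrite iterSr -natr1 => an; apply: IHn; apply: le_trans (norm_fold a) _.
by rewrite ge_max; apply/andP; split; have : 0 <= n%:R :> R by []; lra.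
Qed.

Lemma iter_fold_limit (n : nat) (a : R) :
  `|a| <= 2 * n%:R + 1 -> iter n fold a = fold_limit a.
Proof.
move=> /norm_iter_fold an; rewrite -(fold_limit_small an) {an}.
by elim: n => //= n <-; rewrite fold_limit_fold.
Qed.

Lemma iter_fold_id (n : nat) (a : R) : `|a| <= 1 -> iter n fold a = a.
Proof. by move=> a1; elim: n => //= n ->; exact: fold_id. Qed.

Lemma fold_steps (a : R) : exists n : nat, `|a| <= 2 * n%:R + 1.
Proof.
exists (Num.truncn `|a|).+1; have := truncnS_gt `|a| => h.
by have := normr_ge0 a; move: h; rewrite -natr1; lra.
Qed.

Lemma norm_fold_limit_le1 (a : R) : `|fold_limit a| <= 1.
Proof.
have [n an] := fold_steps a; rewrite -(iter_fold_limit an).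
exact: norm_iter_fold.
Qed.

Lemma norm_iter_fold_le (n : nat) (a : R) : `|iter n fold a| <= `|a|.
Proof. by elim: n => //= n; apply: le_trans; exact: norm_fold_le. Qed.

Lemma iter_fold_sub_limit (n : nat) (a : R) :
  `|iter n fold a - fold_limit a| <= 2 * `|a|.
Proof.
have [m am] := fold_steps a; rewrite -(iter_fold_limit am).
by have := norm_iter_fold_le n a; have := norm_iter_fold_le m a;
  rewrite !ler_norml => ? ?; apply/andP; split; lra.
Qed.

Lemma fold_limit_iter (n : nat) (a : R) :
  fold_limit (iter n fold a) = fold_limit a.
Proof. by elim: n => //= n <-; rewrite fold_limit_fold. Qed.

(** * The isometry from X_p onto L^p(-1, 1) *)

Lemma sqrt2_gt0 : 0 < Num.sqrt (2 : R).
Proof. by rewrite sqrtr_gt0. Qed.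

Lemma sqrt2_sqr : Num.sqrt (2 : R) * Num.sqrt 2 = 2.
Proof. by rewrite -expr2 sqr_sqrtr. Qed.

Lemma rotR_vec2 (a b v d : R) : vec2 a b = rotR *m vec2 v d <->
  a = (v + d) / Num.sqrt 2 /\ b = (d - v) / Num.sqrt 2.
Proof.
have E0 : (rotR *m vec2 v d : 'cV[R]_2) ord0 ord0 = (v + d) / Num.sqrt 2.
  by rewrite !mxE !big_ord_recl big_ord0 !mxE/=; ring.
have E1 : (rotR *m vec2 v d : 'cV[R]_2) (lift ord0 ord0) ord0 = (d - v) / Num.sqrt 2.
  by rewrite !mxE !big_ord_recl big_ord0 !mxE/=; ring.
split=> [ab|[-> ->]].
  by split; [rewrite -E0 -ab mxE|rewrite -E1 -ab mxE].
apply/matrixP => i j; rewrite (ord1 j); case: (unliftP ord0 i) => [k ->|->].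
  by rewrite (ord1 k) E1 mxE.
by rewrite E0 mxE.
Qed.

Lemma isI_unique (U : @state R) (g g' : R -> R) : isI U g -> isI U g' ->
  {ae mu, forall s, -1 < s < 1 -> g s = g' s}.
Proof.
move=> Ig Ig'; apply: ae_symmetric; apply: aeS2 Ig Ig' => s /[swap] h' /[swap] s01.
move: (h' s01) => /rotR_vec2[-> ->] /(_ s01) /rotR_vec2[-> ->].
by [].
Qed.

(** A state whose two components have the d'Alembert form at time [t] is mapped
    by the isometry to the window of [g] centred at [t]. *)
Lemma isI_profile (U : @state R) (g : R -> R) (t C : R) :
  measurable_fun (`]0, 1[%classic : set mR) U.1 ->
  mu.-integrable `]0, 1[ (EFin \o profile_x g t) ->
  {ae mu, forall x, 0 < x < 1 -> U.1 x = C + \int[mu]_(y in `]0, x[) profile_x g t y} ->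
  {ae mu, forall x, 0 < x < 1 -> U.2 x = profile_t g t x} ->
  mu.-integrable `]0, 1[ (EFin \o weak_derivative U.1) /\
  isI U (fun s => g (t + s)).
Proof.
move=> mU ig U1 U2.
have [iW WE] := weak_derivative_unique (is_weak_derivative_primitive mU ig U1).
split=> //; have aeW12 := aeI WE U2.
have ne01 := aeI (ae_neq 0) (ae_neq 1).
apply: aeS2 ne01 aeW12 => s [s0 s1] [h1 h2] /andP[s0' s1'].
have s01 : 0 < s < 1 by rewrite !lt_neqAle s0' s1' eq_sym s0 s1.
apply/rotR_vec2; rewrite h1// h2// /profile_x /profile_t.
have q0 := lt0r_neq0 sqrt2_gt0.
by split; apply: (mulIf q0); apply: (mulIf q0); rewrite divfK// -[LHS]mulrA sqrt2_sqr;
  rewrite mulrDl ?mulNr ?opprK !divfK//; ring.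
Qed.

Section NormX.
Variables (U : @state R) (g : R -> R).
Hypothesis Ig : isI U g.

(** The norm of X_p, for finite and for infinite [p], is read off from these two
    identities. *)
Lemma isI_norms : {ae mu, forall s, 0 < s < 1 ->
  `|weak_derivative U.1 s + U.2 s| = Num.sqrt 2 * `|g s| /\
  `|weak_derivative U.1 s - U.2 s| = Num.sqrt 2 * `|g (- s)|}.
Proof.
apply: aeS Ig => s h /andP[s0 s1].
have /h/rotR_vec2[-> ->] : 0 <= s <= 1 by rewrite !ltW.
have q0 := lt0r_neq0 sqrt2_gt0.
rewrite !normrM normfV !(gtr0_norm sqrt2_gt0) !(mulrC (Num.sqrt 2)) !divfK//.
by split; rewrite -normrN; congr (`| _ |); ring.
Qed.

Let sup_plus := EFin \o ((fun x => weak_derivative U.1 x + U.2 x)%R \_ `]0%R, 1%R[).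
Let sup_minus := EFin \o ((fun x => weak_derivative U.1 x - U.2 x)%R \_ `]0%R, 1%R[).

Lemma Lnorm_oo_ge (F : mR -> \bar R) :
  {ae mu, forall x, (`|F x| <= 'N[mu]_+oo[F])%E}.
Proof. by rewrite unlock mu_setT_gt0; exact: (ess_sup_ge mu (abse \o F)). Qed.

Lemma Lnorm_oo_le (F : mR -> \bar R) (y : \bar R) :
  {ae mu, forall x, (`|F x| <= y)%E} -> ('N[mu]_+oo[F] <= y)%E.
Proof. by rewrite unlock mu_setT_gt0 => h; apply/ess_supP. Qed.

Lemma normX_oo_ge : {ae mu, forall s, -1 < s < 1 -> (`|g s|%:E <= normX +oo U)%E}.
Proof.
have scale (a : R) (N M : \bar R) : ((Num.sqrt 2 * `|a|)%:E <= N)%E -> (N <= M)%E ->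
    (`|a|%:E <= ((Num.sqrt 2)^-1)%:E * M)%E.
  move=> aN NM.
  have -> : `|a| = (Num.sqrt 2)^-1 * (Num.sqrt 2 * `|a|).
    by rewrite mulKf// lt0r_neq0// sqrt2_gt0.
  rewrite EFinM lee_pmul2l// ?lte_fin ?invr_gt0 ?sqrt2_gt0//.
  exact: le_trans aN NM.
apply: ae_symmetric.
have ne01 := aeI (ae_neq 0) (ae_neq 1).
have sups := aeI (Lnorm_oo_ge sup_plus) (Lnorm_oo_ge sup_minus).
have all3 := aeI sups isI_norms.
apply: aeS2 ne01 all3 => s [s0 s1] [[hp hm] h] /andP[s0' s1'].
have s01 : 0 < s < 1 by rewrite !lt_neqAle s0' s1' eq_sym s0 s1.
have [np nm] := h s01.
have sD : s \in (`]0, 1[%classic : set R) by rewrite inE/= in_itv/=.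
split.
  apply: (scale _ 'N[mu]_+oo[sup_minus]%E); last by rewrite le_max lexx orbT.
  by move: hm; rewrite /sup_minus/= patchE sD nm.
apply: (scale _ 'N[mu]_+oo[sup_plus]%E); last by rewrite le_max lexx.
by move: hp; rewrite /sup_plus/= patchE sD np.
Qed.

Lemma normX_oo_le (M : R) : 0 <= M ->
  {ae mu, forall s, -1 < s < 1 -> `|g s| <= M} -> (normX +oo U <= M%:E)%E.
Proof.
move=> M0 gM.
have gM' : {ae mu, forall s, -1 < - s < 1 -> `|g (- s)| <= M}.
  by apply: aeS (preserving_ae (preserving_reflect 0) gM) => s; rewrite sub0r.
have all3 := aeI (aeI gM gM') isI_norms.
rewrite /normX; have -> : M = (Num.sqrt 2)^-1 * (Num.sqrt 2 * M).
  by rewrite mulKf// lt0r_neq0// sqrt2_gt0.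
rewrite EFinM lee_pmul2l// ?lte_fin ?invr_gt0 ?sqrt2_gt0// ge_max.
have q := sqrt2_gt0.
have qM : 0 <= Num.sqrt 2 * M by rewrite mulr_ge0// ltW.
apply/andP; split; apply: Lnorm_oo_le; apply: aeS all3 => s [[h h'] n].
  rewrite /= patchE lee_fin; case: ifPn; last by rewrite normr0.
  rewrite inE/= in_itv/= => s01; have [-> _] := n s01; rewrite ler_pM2l//.
  by apply: h; case/andP: s01 => ? ?; apply/andP; split; lra.
rewrite /= patchE lee_fin; case: ifPn; last by rewrite normr0.
rewrite inE/= in_itv/= => s01; have [_ ->] := n s01; rewrite ler_pM2l//.
by apply: h'; case/andP: s01 => ? ?; apply/andP; split; lra.
Qed.

Lemma normX_fin (r : R) :
  measurable_fun (`]0, 1[%classic : set mR) (weak_derivative U.1) ->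
  measurable_fun (`]0, 1[%classic : set mR) U.2 ->
  measurable_fun (`]-1, 1[%classic : set mR) g ->
  normX r%:E U =
  ((\int[mu]_(s in `]0%R, 1%R[) (`|g s| `^ r + `|g (- s)| `^ r)%:E) `^ r^-1)%E.
Proof.
move=> mW mU mg; rewrite /normX; congr (_ `^ _)%E.
have m01 : measurable (`]0, 1[%classic : set mR) by exact: measurable_itv.
have m11 : measurable (`]-1, 1[%classic : set mR) by exact: measurable_itv.
have mpow (h : R -> R) : measurable_fun (`]0, 1[%classic : set mR) h ->
    measurable_fun (`]0, 1[%classic : set mR) (fun s => `|h s| `^ r).
  move=> mh; apply: (measurableT_comp (f := fun x : R => x `^ r)) => //.
  exact: measurableT_comp.
have mg1 : measurable_fun (`]0, 1[%classic : set mR) g.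
  by apply: measurable_funS mg => // s /=; rewrite !in_itv/= => /andP[? ->]; lra.
have mg2 : measurable_fun (`]0, 1[%classic : set mR) (fun s => g (- s)).
  have -> : (fun s => g (- s)) = g \o (fun x : mR => 0 - x : mR).
    by apply/funext => s /=; rewrite sub0r.
  apply: (preserving_measurableS (preserving_reflect 0) m11 _ mg) => s /=.
  by rewrite !in_itv/= sub0r => /andP[? ?]; apply/andP; split; lra.
have mW1 := measurable_funD (mpow _ (measurable_funD mW mU))
  (mpow _ (measurable_funB mW mU)).
have mG := measurable_funD (mpow _ mg1) (mpow _ mg2).
transitivity ((2 `^ (- (r / 2)))%:E * \int[mu]_(s in `]0%R, 1%R[)
    ((Num.sqrt 2 `^ r)%:E * (`|g s| `^ r + `|g (- s)| `^ r)%:E))%E.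
  congr (_ * _)%E; apply: ae_eq_integral => //.
  - exact/measurable_EFinP.
  - by apply: emeasurable_funM; apply/measurable_EFinP.
  - apply: aeS isI_norms => s h /=; rewrite in_itv/= => /h[np nm].
    by rewrite np nm !powRM ?(ltW sqrt2_gt0)// -EFinM mulrDr.
rewrite ge0_integralZl ?lee_fin ?powR_ge0//; last exact/measurable_EFinP.
rewrite muleA -EFinM -powR12_sqrt// -powRrM (mulrC 2^-1) -powRD.
  by rewrite addNr powRr0 mul1e.
by apply/implyP => _; rewrite pnatr_eq0.
Qed.

End NormX.

Lemma normX_oo_ge0 (V : @state R) : (0 <= normX +oo V)%E.
Proof.
rewrite /normX mule_ge0 ?lee_fin ?invr_ge0 ?sqrtr_ge0// le_max.
by rewrite Lnorm_ge0.
Qed.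

Lemma normX_oo_eq0 (V : @state R) (h : R -> R) : isI V h ->
  {ae mu, forall s, -1 < s < 1 -> h s = 0} -> normX +oo V = 0%E.
Proof.
move=> Ih h0; apply/eqP; rewrite eq_le; apply/andP; split; last exact: normX_oo_ge0.
by apply: (normX_oo_le Ih (lexx 0)); apply: aeS h0 => s /[apply] ->; rewrite normr0.
Qed.

(** * The recurrence satisfied by g *)

Section Dynamics.
Variables (p : \bar R) (U : @state R) (z : R -> R -> R) (f g : R -> R).
Hypotheses (p1 : (1 <= p)%E) (hz : wave_solution p SigmaSign U z f g).

Lemma SigmaSign_fold (a b : R) :
  SigmaSign ((a - b) / Num.sqrt 2, (a + b) / Num.sqrt 2) -> b = fold a.
Proof.
have q := sqrt2_gt0; have qq := sqrt2_sqr.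
have E (y c : R) : y / Num.sqrt 2 = c * Num.sqrt 2 -> y = c * 2.
  move=> yc; have := congr1 (fun x => x * Num.sqrt 2) yc.
  by rewrite (divfK (lt0r_neq0 q)) -[in RHS]mulrA qq.
rewrite /SigmaSign/= pmulr_lle0 ?invr_gt0// pmulr_lge0 ?invr_gt0//.
rewrite ler_pdivlMr// ler_pdivrMr// mulNr qq.
case=> [[[ab s]|[/eqP]]|[ab s]].
- have : a + b = -1 * 2 by apply: E; rewrite s mulN1r.
  rewrite /fold; case: ifPn => ?; [lra|case: ifPn; lra].
- rewrite mulf_eq0 invr_eq0 (gt_eqF q) orbF subr_eq0 => /eqP <- /andP[? ?].
  by rewrite fold_id// ler_norml; apply/andP; split; lra.
- have : a + b = 1 * 2 by apply: E; rewrite s mul1r.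
  rewrite /fold; case: ifPn => ?; [lra|case: ifPn; lra].
Qed.

(** At [x = 1] and time [1 + s] the boundary sees [g s] arriving and sends back
    [f (2 + s) = - g (2 + s)]. *)
Lemma wave_fold : {ae mu, forall s, -1 < s -> g (2 + s) = fold (g s)}.
Proof.
have [_ _ bc _] := hz.
apply: aeS2 (preserving_ae (preserving_shift 1) bc)
  (preserving_ae (preserving_shift 2) (wave_f_oppg p1 hz)) => s hb hf s1.
have [_] : z (1 + s) 0 = 0 /\ SigmaSign (wave_t f g (1 + s) 1, - wave_x f g (1 + s) 1).
  by apply: hb; lra.
have -> : wave_t f g (1 + s) 1 = (g s - g (2 + s)) / Num.sqrt 2.
  rewrite /wave_t; have -> : 1 + s + 1 = 2 + s by ring.
  rewrite hf; last lra.
  by rewrite addrC; congr ((g _ - _) / _); ring.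
have -> : - wave_x f g (1 + s) 1 = (g s + g (2 + s)) / Num.sqrt 2.
  rewrite /wave_x; have -> : 1 + s + 1 = 2 + s by ring.
  rewrite hf; last lra.
  have -> : 1 + s - 1 = s by ring.
  by ring.
exact: SigmaSign_fold.
Qed.

Lemma wave_iter : {ae mu, forall s, forall n : nat, -1 < s ->
  g (2 * n%:R + s) = iter n fold (g s)}.
Proof.
apply: ae_forall_nat; elim=> [|n IHn].
  by apply: aeW => s _; rewrite mulr0 add0r.
apply: aeS2 IHn (preserving_ae (preserving_shift (2 * n%:R)) wave_fold) => s IH h s1.
rewrite iterS -IH// -h; last by rewrite ltr_wpDl// mulr_ge0.
by congr g; rewrite -natr1; ring.
Qed.

Lemma wave_isI : inX p U -> isI U g.
Proof.
move=> [[_ U1 _ _] U2]; have [_ zE _ ic] := hz.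
have ig := integrable_profile_x (wave_integrable_g p1 hz) (lexx 0) (lexx 1).
have m01 : measurable (`]0, 1[%classic : set mR) by exact: measurable_itv.
have [||_] := isI_profile (U := U) (g := g) (t := 0) (C := 0) (inLp_measurable m01 U1) ig.
- apply: aeS ic => x h /andP[x0 x1]; have x01 : 0 <= x <= 1 by rewrite !ltW.
  by have [<- _] := h x01; rewrite add0r (wave_profile p1 hz).
- apply: aeS2 ic (wave_t_profile p1 hz (lexx 0)) => x h h' /andP[x0 x1].
  have x01 : 0 <= x <= 1 by rewrite !ltW.
  by have [_ <-] := h x01; rewrite h'// x0.
by congr (isI _ _); apply/funext => s; rewrite add0r.
Qed.

End Dynamics.

(** * Comparison of two solutions *)

Section TwoWaves.
Variables (p : \bar R) (Sigma Sigma' : set (R * R)) (U U' : @state R).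
Variables (z z' : R -> R -> R) (f g f' g' : R -> R).
Hypotheses (p1 : (1 <= p)%E).
Hypotheses (hz : wave_solution p Sigma U z f g).
Hypotheses (hz' : wave_solution p Sigma' U' z' f' g').

Lemma traj_eqX (t t' : R) : 0 <= t -> 0 <= t' ->
  {ae mu, forall s, -1 < s < 1 -> g (t + s) = g' (t' + s)} ->
  eqX (traj z f g t) (traj z' f' g' t').
Proof.
move=> t0 t'0 gg'.
have gg'N : {ae mu, forall s, -1 < - s < 1 -> g (t - s) = g' (t' - s)}.
  by apply: aeS (preserving_ae (preserving_reflect 0) gg') => s; rewrite sub0r.
have both := aeI gg' gg'N.
split=> [x x01|].
  rewrite /= (wave_profile p1 hz)// (wave_profile p1 hz')//.
  have /andP[x0 x1] := x01; apply: Rintegral_ae_eq.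
  - exact: measurable_itv.
  - exact: (integrable_measurable (integrable_profile_x (wave_integrable_g p1 hz) t0 x1)).
  - exact: (integrable_measurable (integrable_profile_x (wave_integrable_g p1 hz') t'0 x1)).
  - apply: aeS both => y [h hN] /=; rewrite in_itv/= => /andP[y0 yx].
    by rewrite /profile_x h ?hN//; apply/andP; split; lra.
have profs := aeI (wave_t_profile p1 hz t0) (wave_t_profile p1 hz' t'0).
apply: aeS2 both profs => y [h hN] [w w'] /andP[y0 y1].
by rewrite /= w ?y0// w' ?y0// /profile_t h ?hN//; apply/andP; split; lra.
Qed.

Lemma traj_sub_isI (t : R) : 0 <= t ->
  let W := subX (traj z f g t) (traj z' f' g' t) in
  mu.-integrable `]0, 1[ (EFin \o weak_derivative W.1) /\
  isI W (fun s => g (t + s) - g' (t + s)).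
Proof.
move=> t0 W; pose h s := g s - g' s.
have ih T : mu.-integrable `]-1, T[ (EFin \o h).
  have m : measurable (`]-1, T[%classic : set mR) by exact: measurable_itv.
  have := integrableB m (wave_integrable_g p1 hz T) (wave_integrable_g p1 hz' T).
  exact: eq_integrable.
have ip := integrable_profile_x ih t0 (lexx 1).
have W1 x : 0 <= x <= 1 -> W.1 x = \int[mu]_(y in `]0, x[) profile_x h t y.
  move=> x01; rewrite /= (wave_profile p1 hz)// (wave_profile p1 hz')//.
  have /andP[x0 x1] := x01.
  rewrite -RintegralB//; last 2 first.
  - exact: integrable_profile_x (wave_integrable_g p1 hz) t0 x1.
  - exact: integrable_profile_x (wave_integrable_g p1 hz') t0 x1.
  by apply: eq_Rintegral => y _; rewrite /profile_x /h; ring.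
apply: (isI_profile (U := W) (g := h) (t := t) (C := 0)) => //.
- apply: eq_measurable_fun (measurable_primitive ip) => x; rewrite inE/= in_itv/=.
  by move=> /andP[x0 x1]; rewrite -W1// !ltW.
- by apply: aeW => x /andP[x0 x1]; rewrite add0r W1// !ltW.
- apply: aeS2 (wave_t_profile p1 hz t0) (wave_t_profile p1 hz' t0) => x w w' x01.
  by rewrite /= w// w'// /profile_t /h; ring.
Qed.

End TwoWaves.

(** * Convergence to the periodic solution *)

Section Convergence.
Variables (p : \bar R) (U U' : @state R).
Variables (z z' : R -> R -> R) (f g f' g' : R -> R).
Hypotheses (p1 : (1 <= p)%E).
Hypotheses (hz : wave_solution p SigmaSign U z f g).
Hypotheses (hz' : wave_solution p SigmaSign U' z' f' g').
Hypothesis g'0 : {ae mu, forall s, -1 < s < 1 -> g' s = fold_limit (g s)}.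

(** Both sides are determined by their values on [(-1, 1)]: values in [[-1, 1]]
    are fixed by [fold], and [fold_limit] is invariant under [fold]. *)
Lemma wave_limit : {ae mu, forall s, -1 < s -> g' s = fold_limit (g s)}.
Proof.
apply: (@ae_windows (-1) 2) => // n.
have iters := aeI (wave_iter p1 hz) (wave_iter p1 hz').
apply: aeS2 iters g'0 => s [h h'] h0 s11; have s1 : -1 < s by case/andP: s11.
rewrite h// h'// fold_limit_iter h0; last by case/andP: s11 => ? ?; apply/andP; split; lra.
by rewrite iter_fold_id// norm_fold_limit_le1.
Qed.

Lemma wave_sub_limit : {ae mu, forall s, forall n : nat, -1 < s ->
  g (2 * n%:R + s) - g' (2 * n%:R + s) = iter n fold (g s) - fold_limit (g s)}.
Proof.
have iters := aeI (wave_iter p1 hz) (wave_iter p1 hz').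
apply: aeS2 iters wave_limit => s [h h'] h0 n s1.
by rewrite h// h'// h0// (iter_fold_id n (norm_fold_limit_le1 _)).
Qed.

Lemma wave_limit_periodic : {ae mu, forall s, -1 < s -> g' (2 + s) = g' s}.
Proof.
apply: aeS2 (wave_fold p1 hz') wave_limit => s h h0 s1.
by rewrite h// fold_id// h0// norm_fold_limit_le1.
Qed.

Lemma wave_finite_time (n : nat) :
  {ae mu, forall s, -1 < s < 1 -> `|g s| <= 2 * n%:R + 1} ->
  {ae mu, forall s, 2 * n%:R - 1 < s -> g s = g' s}.
Proof.
move=> gn; apply: (@ae_windows _ 2) => // m.
have both := aeI gn wave_sub_limit.
apply: aeS (preserving_ae (preserving_shift (- (2 * n%:R))) both) => s [b h] /andP[s1 s2].
have sn : -1 < - (2 * n%:R) + s < 1 by apply/andP; split; lra.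
have := h (m + n)%N (proj1 (andP sn)).
have -> : 2 * (m + n)%:R + (- (2 * n%:R) + s) = 2 * m%:R + s by rewrite natrD; ring.
rewrite iter_fold_limit ?subrr => [/eqP|]; first by rewrite subr_eq0 => /eqP.
apply: le_trans (b sn) _; rewrite natrD.
by have : 0 <= m%:R :> R by []; lra.
Qed.

Lemma wave_sub_measurable :
  measurable_fun (`]-1, +oo[%classic : set mR) (fun s => g s - g' s).
Proof.
have [[_ [mg _]] _ _ _] := hz; have [[_ [mg' _]] _ _ _] := hz'.
exact: measurable_funB.
Qed.

Lemma wave_sub_window_measurable (t a b : R) : -1 <= t + a ->
  measurable_fun (`]a, b[%classic : set mR) (fun s => g (t + s) - g' (t + s)).
Proof.
move=> ta; apply: (preserving_measurableS (preserving_shift t) _ _ wave_sub_measurable).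
  exact: measurable_itv.
by move=> s /=; rewrite !in_itv/= andbT => /andP[s1 _]; lra.
Qed.

(** The r-th power of the distance in X_r between the two solutions at time [t]. *)
Definition energy (r t : R) : \bar R :=
  (\int[mu]_(s in `]0%R, 1%R[)
    (`|g (t + s) - g' (t + s)| `^ r + `|g (t - s) - g' (t - s)| `^ r)%:E)%E.

(** Dominated convergence: the integrand vanishes for [n] large at each point,
    and stays below [(2 * `|g s|) `^ r]. *)
Lemma window_energy_cvg0 (r : R) : p = r%:E ->
  (\int[mu]_(s in `](-1)%R, 3%R[)
    (`|g (2 * n%:R + s) - g' (2 * n%:R + s)| `^ r)%:E)%E @[n --> \oo] --> 0%E.
Proof.
move=> pr; have r1 : 1 <= r by rewrite -lee_fin -pr.
have m13 : measurable (`]-1, 3[%classic : set mR) by exact: measurable_itv.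
have [[_ [_ lg]] _ _ _] := hz.
have glr : inLp r%:E `]-1, 3[ g by rewrite -pr; apply: lg; lra.
have ig := inLp_integrable_powR m13 r1 glr.
have igr : mu.-integrable `]-1, 3[ (EFin \o (fun s => 2 `^ r * `|g s| `^ r)).
  by have := integrableZl m13 (2 `^ r) ig; apply: eq_integrable.
pose F n s := (`|g (2 * n%:R + s) - g' (2 * n%:R + s)| `^ r)%:E.
have mF n : measurable_fun (`]-1, 3[%classic : set mR) (F n).
  apply/measurable_EFinP; apply: (measurableT_comp (f := fun x : R => x `^ r)) => //.
  apply: measurableT_comp => //; apply: wave_sub_window_measurable.
  by have : 0 <= n%:R :> R by []; lra.
have [||||_ _] := @dominated_convergence _ _ _ mu _ m13 F (cst 0%E)
  (EFin \o (fun s => 2 `^ r * `|g s| `^ r)) mF.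
- exact: measurable_cst.
- apply: aeS wave_sub_limit => s h /=; rewrite in_itv/= => /andP[s1 _].
  have [m gm] := fold_steps (g s).
  apply: cvg_near_cst; near=> n.
  rewrite /F h// iter_fold_limit.
    by rewrite subrr normr0 powR0// gt_eqF// (lt_le_trans ltr01 r1).
  apply: le_trans gm _; rewrite lerD2r ler_pM2l// ler_nat.
  by near: n; exact: nbhs_infty_ge.
- exact: igr.
- apply: aeS wave_sub_limit => s h n /=; rewrite in_itv/= => /andP[s1 _].
  rewrite ger0_norm ?powR_ge0// h// lee_fin -powRM//.
  by rewrite ge0_ler_powR ?nnegrE ?mulr_ge0 ?iter_fold_sub_limit//; lra.
by rewrite integral0.
Unshelve. all: by end_near. Qed.

(** For [t] between [2 n] and [2 n + 2], the interval [(t - 1, t + 1)] lies in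
    [(2 n - 1, 2 n + 3)]. *)
Lemma energy_le (r t : R) (n : nat) : 2 * n%:R <= t -> t < 2 * n%:R + 2 ->
  (energy r t <= 2%:E * \int[mu]_(s in `](-1)%R, 3%R[)
    (`|g (2 * n%:R + s) - g' (2 * n%:R + s)| `^ r)%:E)%E.
Proof.
move=> nt tn; pose F s := `|g (2 * n%:R + s) - g' (2 * n%:R + s)| `^ r.
have m13 : measurable (`]-1, 3[%classic : set mR) by exact: measurable_itv.
have m01 : measurable (`]0, 1[%classic : set mR) by exact: measurable_itv.
have mF : measurable_fun (`]-1, 3[%classic : set mR) F.
  apply: (measurableT_comp (f := fun x : R => x `^ r)) => //.
  apply: measurableT_comp => //; apply: wave_sub_window_measurable.
  by have : 0 <= n%:R :> R by []; lra.
have F0 s : (0 <= (F s)%:E)%E by rewrite lee_fin powR_ge0.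
have part (phi : mR -> mR) : measure_preserving phi ->
    (forall s, 0 < s < 1 -> -1 < phi s < 3) ->
    measurable_fun (`]0, 1[%classic : set mR) (F \o phi) /\
    (\int[mu]_(s in `]0%R, 1%R[) (F (phi s))%:E <=
     \int[mu]_(s in `](-1)%R, 3%R[) (F s)%:E)%E.
  move=> hphi phi13.
  have sub : `]0, 1[%classic `<=` phi @^-1` `]-1, 3[.
    by move=> s /=; rewrite !in_itv/= => /phi13.
  have mFphi := preserving_measurable hphi m13 mF.
  have mpre := preserving_preimage hphi m13.
  split; first exact: measurable_funS mFphi.
  rewrite [leRHS](preserving_integral hphi m13); last exact/measurable_EFinP.
  by apply: ge0_subset_integral => //; exact/measurable_EFinP.
have [|mp lep] := part _ (preserving_shift (t - 2 * n%:R)).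
  by move=> s /andP[s0 s1]; apply/andP; split; lra.
have [|mm lem] := part _ (preserving_reflect (t - 2 * n%:R)).
  by move=> s /andP[s0 s1]; apply/andP; split; lra.
rewrite /energy (_ : 2%:E = 1%:E + 1%:E)%E; last by rewrite -EFinD.
rewrite ge0_muleDl ?lee_fin// mul1e.
apply: le_trans (leeD lep lem).
have mp' := (measurable_EFinP _ _).2 mp; have mm' := (measurable_EFinP _ _).2 mm.
have := ge0_integralD mu m01 (fun s _ => F0 _) mp' (fun s _ => F0 _) mm'.
move=> /= <-.
rewrite le_eqVlt; apply/orP; left; apply/eqP; apply: eq_integral => s _.
have E1 : 2 * n%:R + (t - 2 * n%:R + s) = t + s by ring.
have E2 : 2 * n%:R + (t - 2 * n%:R - s) = t - s by ring.
by rewrite -EFinD /F E1 E2.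
Qed.

Lemma normX_traj_sub (r t : R) : 0 <= t ->
  normX r%:E (subX (traj z f g t) (traj z' f' g' t)) = (energy r t `^ r^-1)%E.
Proof.
move=> t0; have [iW IW] := traj_sub_isI p1 hz hz' t0.
rewrite (normX_fin IW) //.
- exact: integrable_measurable.
- apply: measurable_funB; first exact: measurable_wave_t hz t0.
  exact: measurable_wave_t hz' t0.
- by apply: wave_sub_window_measurable; lra.
Qed.

Lemma normX_traj_sub_cvg0 (r : R) : p = r%:E ->
  normX r%:E (subX (traj z f g t) (traj z' f' g' t)) @[t --> +oo] --> 0%E.
Proof.
move=> pr; have r1 : 1 <= r by rewrite -lee_fin -pr.
have r0 : 0 < r by exact: lt_le_trans r1.
suff small (e : R) : 0 < e -> \forall t \near +oo,
    (0 <= normX r%:E (subX (traj z f g t) (traj z' f' g' t)) <= e%:E)%E.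
  apply/fine_cvgP; split.
    near=> t; have /andP[n0 n1] : (0 <= normX r%:E
      (subX (traj z f g t) (traj z' f' g' t)) <= 1%:E)%E by near: t; exact: small.
    by rewrite ge0_fin_numE// (le_lt_trans n1)// ltry.
  apply/cvgrPdist_le => e e0; near=> t; have /andP[n0 n1] : (0 <= normX r%:E
    (subX (traj z f g t) (traj z' f' g' t)) <= e%:E)%E by near: t; exact: small.
  rewrite sub0r normrN ger0_norm ?fine_ge0// -lee_fin fineK//.
  by rewrite ge0_fin_numE// (le_lt_trans n1)// ltry.
move=> e0; have /fine_cvgP[Efin /cvgrPdist_le Ecvg] := window_energy_cvg0 pr.
have d0 : 0 < e `^ r / 2 by rewrite divr_gt0// powR_gt0.
have [N _ EN] := filterI Efin (Ecvg _ d0).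
near=> t.
have t2 : 2 * N%:R <= t by near: t; exact: nbhs_pinfty_ge.
have t0 : 0 <= t by apply: le_trans t2; rewrite mulr_ge0.
rewrite normX_traj_sub// poweR_ge0/=.
have h0 : 0 <= t / 2 by rewrite divr_ge0.
have /andP[n1 n2] := truncn_itv h0; set n := Num.truncn _ in n1 n2.
have nN : (N <= n)%N by rewrite truncn_ge_nat// ler_pdivlMr// mulrC.
have [En1 En2] := EN n nN.
have le1 := energy_le r (n := n) (t := t).
have Ene : (energy r t <= (e `^ r)%:E)%E.
  apply: (le_trans (le1 _ _)).
  - by move: n1; rewrite ler_pdivlMr// mulrC.
  - by move: n2; rewrite ltr_pdivrMr// -natr1; lra.
  rewrite -(fineK En1) -EFinM lee_fin.
  move: En2; rewrite /= sub0r normrN => /(le_trans (ler_norm _)).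
  by rewrite ler_pdivlMr// mulrC.
have en0 : (0 <= energy r t)%E.
  by apply: integral_ge0 => s _; rewrite lee_fin addr_ge0// powR_ge0.
have -> : e = (e `^ r) `^ r^-1.
  by rewrite -powRrM divff ?powRr1 ?ltW// gt_eqF.
rewrite -poweR_EFin; apply: gt0_ler_poweR => //.
- by rewrite invr_ge0 ltW.
- by rewrite in_itv/= en0 leey.
- by rewrite in_itv/= lee_fin powR_ge0 leey.
Unshelve. all: by end_near. Qed.

End Convergence.

End WaveConvergence.

Theorem theorem71 (R : realType) (p : \bar R) (hp : (1 <= p)%E)
    (U0 : @state R) (hU0 : inX p U0)
    (z : R -> R -> R) (f g : R -> R)
    (hz : wave_solution p SigmaSign U0 z f g)
    (g0 : R -> R) (hg0 : inY p g0) (hI : isI U0 g0)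
    (Uinf : @state R) (hUinf : inX p Uinf) (hIinf : isI Uinf (ginf g0))
    (zinf : R -> R -> R) (finf gfinf : R -> R)
    (hzinf : wave_solution p SigmaSign Uinf zinf finf gfinf) :
  [/\ forall t, 0 <= t ->
        eqX (traj zinf finf gfinf (t + 2)) (traj zinf finf gfinf t),
      (fun t => normX p (subX (traj z f g t) (traj zinf finf gfinf t)))
        @ +oo --> 0%E &
      p = +oo%E -> forall t,
        2 * (Num.floor ((fine (normX +oo%E U0) + 1) / 2))%:~R <= t ->
        eqX (traj z f g t) (traj zinf finf gfinf t)].
Proof.
have gE := isI_unique (wave_isI hp hz hU0) hI.
have limE : {ae lebesgue_measure, forall s, -1 < s < 1 -> gfinf s = fold_limit (g s)}.
  apply: aeS2 gE (isI_unique (wave_isI hp hzinf hUinf) hIinf) => s h h' s11.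
  by rewrite h'// h.
have finite_time : p = +oo%E -> exists2 T : R, 0 <= T &
    T = 2 * (Num.floor ((fine (normX +oo%E U0) + 1) / 2))%:~R /\
    {ae lebesgue_measure, forall s, T - 1 < s -> g s = gfinf s}.
  move=> pE; rewrite pE in hg0; have [B gB] := inLp_oo_bound hg0.
  have N0 := normX_oo_ge hI.
  have [M NE] : exists M, normX +oo%E U0 = M%:E.
    exists (fine (normX +oo%E U0)); rewrite fineK// ge0_fin_numE ?normX_oo_ge0//.
    apply: le_lt_trans (ltry (Num.max B 0)); apply: (normX_oo_le hI).
      by rewrite le_max lexx orbT.
    by apply: aeS gB => s h s11; rewrite le_max h.
  have M0 : 0 <= M by rewrite -lee_fin -NE normX_oo_ge0.
  (* With [k] the floor of [(M + 1) / 2], [`|g0| <= M < 2 k + 1], so [k]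
     applications of [fold] suffice everywhere. *)
  rewrite NE /=; set k := Num.floor _.
  have k0 : 0 <= k by rewrite floor_ge0 divr_ge0// addr_ge0.
  exists (2 * k%:~R); first by rewrite mulr_ge0// ler0z.
  split=> //; have kE : k%:~R = `|k|%N%:R :> R by rewrite -[in LHS](gez0_abs k0).
  rewrite kE.
  apply: (wave_finite_time hp hz hzinf limE).
  apply: aeS2 gE N0 => s h hN s11; rewrite h//.
  move: (hN s11); rewrite NE lee_fin => /le_trans; apply.
  by have := floorD1_gt ((M + 1) / 2); rewrite -/k intrD kE; lra.
split.
- move=> t t0; apply: (traj_eqX hp hzinf hzinf) => //; first lra.
  have := preserving_ae (preserving_shift t) (wave_limit_periodic hp hz hzinf limE).
  apply: aeS => s h /andP[s1 _]; have := h _; rewrite addrA (addrC 2) => -> //.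
  by lra.
- case: p hp hU0 hz hg0 hUinf hzinf gE limE finite_time => [r| |//].
    move=> hp hU0 hz hg0 hUinf hzinf gE limE _.
    exact: (normX_traj_sub_cvg0 hp hz hzinf limE).
  move=> hp hU0 hz hg0 hUinf hzinf gE limE /(_ erefl)[T T0 [_ gT]].
  apply: cvg_near_cst; near=> t.
  have Tt : T <= t by near: t; apply: nbhs_pinfty_ge; exact: num_real.
  have [_ IW] := traj_sub_isI hp hz hzinf (le_trans T0 Tt).
  apply: (normX_oo_eq0 IW).
  apply: aeS (preserving_ae (preserving_shift t) gT) => s h /andP[s1 _].
  by rewrite h ?subrr//; lra.
- move=> /finite_time[T T0 [<- gT]] t Tt.
  have t0 := le_trans T0 Tt.
  apply: (traj_eqX hp hz hzinf) => //.
  apply: aeS (preserving_ae (preserving_shift t) gT) => s h /andP[s1 _].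
  by rewrite h//; lra.
Unshelve. all: by end_near. Qed.
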